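(* Let $p$ and $q$ be odd relatively prime positive integers, and let $T_{p,q}\subset S^3$ be the right-handed $(p,q)$-torus knot. Then the Floer chain complex $IC^{\natural}(T_{p,q})$ has total rank $1+4a$, where $a=-\operatorname{sign}(T_{p,q})/4$ and $\operatorname{sign}$ denotes the knot signature.
   Context: **Convention.** The signature is normalized so that right-handed torus knots have non-positive signature. **Link homology.** Let $\Sigma$ be an oriented integral homology 3-sphere, $\mathcal{L}\subset\Sigma$ a two-component link with exterior $X$, and $P\to X$ the unique $SO(3)$ bundle with $0\neq w_2(P)\in H^2(X;\mathbb{Z}/2)=\mathbb{Z}/2$, viewed as an orbifold bundle over $\Sigma$ with cone angle $\pi$ along $\mathcal{L}$. $IC_*(\Sigma,\mathcal{L})$ is Kronheimer and Mrowka's singular instanton chain complex: the Morse complex of the orbifold Chern--Simons functional on orbifold connections in $P$ modulo the restricted orbifold gauge group (determinant-one orbifold gauge group divided by $\{\pm1\}$). For a non-split link, the critical points are the conjugacy classes of projective representations $\pi_1X\to SU(2)$ with a fixed $\{\pm1\}$-valued cocycle $c$, $0\ne[c]\in H^2(X;\mathbb{Z}/2)$. **Knot homology.** For a knot $k\subset S^3$, $IC^{\natural}(k)=IC_*(S^3,k^{\natural})$, where $k^{\natural}=k\cup\ell$ is the connected sum of $k$ with the Hopf link. With $\pi_1(S^3-k)=\langle a_1,\dots,a_n\mid r_j\rangle$ a Wirtinger presentation and $b$ the meridian of $\ell$ (commuting with $a_1$), the critical points are tuples $(A_1,\dots,A_n;B)$ of $SU(2)$ matrices satisfying the relations $r_j$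 and $A_1B=-BA_1$, up to conjugation. When the space of traceless $SU(2)$ representations of $\pi_1(S^3-k)$ modulo conjugation is non-degenerate (as is the case here), the critical set consists of the isolated point $\alpha=(i,\dots,i;j)$ and one Morse--Bott circle for each conjugacy class of irreducible traceless representations $\pi_1(S^3-k)\to SU(2)$. The generators of $IC^{\natural}(k)$ are then $\alpha$ together with two generators obtained by perturbing each Morse--Bott circle. *)

(* Defs.v *)
From HB Require Import structures.
From mathcomp Require Import complex freeg.
From mathcomp Require Import all_boot all_order all_algebra.
From mathcomp Require Import boolp classical_sets reals.

Set Implicit Arguments.
Unset Strict Implicit.
Unset Printing Implicit Defensive.

Import Order.TTheory GRing.Theory Num.Theory.
Local Open Scope ring_scope.
Local Open Scope classical_set_scope.

(* A link is given as the closure of a word in the Artin generators of the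
   braid group on n.+1 strands.  Strands run upwards, letters are read from
   bottom to top, and positions are numbered from left to right.  The letter
   (i, b) is a crossing between positions i and i.+1; it is positive
   (right-handed) iff b = true. *)
Definition braid (n : nat) := seq ('I_n * bool).

(* (sigma_1 ... sigma_{p-1})^q on p strands.  All crossings are positive, so
   the closure is the right-handed (p,q)-torus link. *)
Definition torus_braid (p q : nat) : braid p.-1 :=
  flatten (nseq q [seq (i, true) | i <- enum 'I_p.-1]).

Section Signature.
Variable R : realType.

Definition posdefmx n (M : 'M[R]_n) : Prop :=
  forall u : 'rV[R]_n, u != 0 -> 0 < (u *m M *m u^T) 0 0.

(* Largest dimension of a subspace on which the form M is positive definite. *)
Definition pos_index n (M : 'M[R]_n) : nat :=
  \max_(k < n.+1 | `[< exists U : 'M[R]_(k, n), posdefmx (U *m M *m U^T) >]) k.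

Definition form_signature n (M : 'M[R]_n) : int :=
  (pos_index M)%:Z - (pos_index (- M))%:Z.

Variables (n : nat) (w : braid n).

Local Notation letter t := (tnth (in_tuple w) t).
Local Notation col t := (nat_of_ord (letter t).1).
Local Notation crossing_sign t := (if (letter t).2 then 1 else -1 : R).

(* The Seifert surface of the closed braid consists of n.+1 stacked discs, one
   per strand (with the disc of strand 0 on top), joined by one half-twisted
   band per letter.  When it is connected, its H_1 has a basis indexed by the
   pairs s < t of consecutive occurrences of the same generator: the loop
   (s, t) traverses the bands s and t, in opposite directions. *)
Definition seifert_loops : {set 'I_(size w) * 'I_(size w)} :=
  [set x : 'I_(size w) * 'I_(size w) |
     [&& (x.1 < x.2)%N, col x.1 == col x.2 &
         [forall u : 'I_(size w),
            (x.1 < u < x.2)%N ==> (col u != col x.1)]]].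

(* The linking number lk(x^+, y) of the positive push-off of x with y. *)
Definition seifert_form (x y : 'I_(size w) * 'I_(size w)) : R :=
  if x == y then - (crossing_sign x.1 + crossing_sign x.2) / 2
  else if col x.1 == col y.1 then
    (* distinct loops between the same two discs meet in at most one band *)
    if x.2 == y.1 then if (letter x.2).2 then 1 else 0
    else if y.2 == x.1 then if (letter x.1).2 then 0 else -1
    else 0
  else if col x.1 == (col y.1).+1 then
    (* the loops share one disc, where they cross iff they interleave *)
    if [&& (y.1 < x.1)%N, (x.1 < y.2)%N & (y.2 < x.2)%N] then 1
    else if [&& (x.1 < y.1)%N, (y.1 < x.2)%N & (x.2 < y.2)%N] then -1
    else 0
  else 0.

Definition seifert_matrix : 'M[R]_#|seifert_loops| :=
  \matrix_(a, b) seifert_form (enum_val a) (enum_val b).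

(* With this convention the right-handed trefoil has signature -2. *)
Definition link_signature : int :=
  form_signature (seifert_matrix + seifert_matrix^T).

End Signature.

Section FloerComplex.
Variable R : realType.
Local Notation C := R[i].
Local Notation M2 := 'M[C]_2.

Definition SU2 : set M2 := [set g | g \is unitarymx /\ \det g = 1].

Definition quat_i : M2 :=
  \matrix_(r, c) if r == c then (-1) ^+ r * 'i else 0.
Definition quat_j : M2 :=
  \matrix_(r, c) if r == c then 0 else (-1) ^+ r.

Variables (n : nat) (w : braid n).

(* The Wirtinger generator of the edge (t, k) is the meridian of the strand at
   position k just below the letter t, or at the top of the braid for
   t = size w.  Arcs are thus subdivided into edges, and the relations include
   the equality of the generators of consecutive edges of one arc. *)
Definition edge := ('I_(size w).+1 * 'I_n.+1)%type.

(* Passing the letter c, from the meridians x below it to y above it.  At a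
   positive crossing the left strand goes over, at a negative one the right
   strand does. *)
Definition crossing_relation (c : 'I_n * bool) (x y : 'I_n.+1 -> M2) : Prop :=
  let l : 'I_n.+1 := widen_ord (leqnSn n) c.1 in
  let r : 'I_n.+1 := lift ord0 c.1 in
  [/\ forall k, k != l -> k != r -> y k = x k,
      if c.2 then y r = x l else y l = x r
    & if c.2 then y l = x l * x r * (x l)^-1 else y r = (x r)^-1 * x l * x r].

Definition wirtinger_relations (A : edge -> M2) : Prop :=
  (forall t : 'I_(size w),
     crossing_relation (tnth (in_tuple w) t)
       (fun k => A (widen_ord (leqnSn _) t, k))
       (fun k => A (lift ord0 t, k)))
  /\ (forall k, A (ord_max, k) = A (ord0, k)).

(* SU(2) representations of the link group, as the tuples of images of the
   Wirtinger generators. *)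
Definition representation : set (edge -> M2) :=
  [set A | (forall e, SU2 (A e)) /\ wirtinger_relations A].

Definition traceless (A : edge -> M2) : Prop := forall e, \tr (A e) = 0.

(* No proper non-zero subspace of C^2 is invariant. *)
Definition irreducible (A : edge -> M2) : Prop :=
  forall U : M2, (forall e, stablemx U (A e)) -> U = 0 \/ row_full U.

Definition conjugate_rep (g : M2) (A : edge -> M2) : edge -> M2 :=
  fun e => g * A e * g^-1.

(* The meridian a_1 to which the Hopf link component is attached. *)
Definition base_edge : edge := (ord0, ord0).

(* Tuples (A_1, ..., A_n; B). *)
Definition config := ((edge -> M2) * M2)%type.

Definition conjugacy_class (X : config) : set config :=
  [set (conjugate_rep g X.1, g * X.2 * g^-1) | g in SU2].

Definition critical_config : set config :=
  [set X | [/\ representation X.1, SU2 X.2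
             & X.1 base_edge * X.2 = - (X.2 * X.1 base_edge)]].

Definition critical_set : set (set config) :=
  [set conjugacy_class X | X in critical_config].

Definition alpha : set config := conjugacy_class (fun=> quat_i, quat_j).

(* The critical points (A; B) with A conjugate to rho. *)
Definition morse_bott_circle (rho : edge -> M2) : set (set config) :=
  [set x | critical_set x /\
     exists g B, SU2 g /\ x = conjugacy_class (conjugate_rep g rho, B)].

(* For non-conjugate irreducible rho these circles are disjoint, hence there is
   one for each conjugacy class. *)
Definition morse_bott_circles : set (set (set config)) :=
  [set morse_bott_circle rho |
     rho in [set A | [/\ representation A, traceless A & irreducible A]]].

(* The isolated critical point alpha, and the minimum and the maximum of a
   perfect Morse function on each Morse-Bott circle. *)
Definition generator : choiceType :=
  (set_type [set alpha] + set_type morse_bott_circles * bool)%type.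

(* The underlying group of the chain complex IC^natural of the closure of w. *)
Definition IC_natural : zmodType := {freeg generator / int}.

End FloerComplex.

Definition free_of_rank (M : zmodType) (r : nat) : Prop :=
  exists e : 'I_r -> M, forall x : M,
    exists! c : {ffun 'I_r -> int}, x = \sum_i e i *~ c i.

(* Main.v *)
Require Import Defs.
From mathcomp Require Import complex freeg.
From mathcomp Require Import all_boot all_order all_algebra separable cyclotomic.
From mathcomp Require Import boolp classical_sets reals.
From mathcomp Require Import ring lra zify.

Set Implicit Arguments.
Unset Strict Implicit.
Unset Printing Implicit Defensive.

Import Order.TTheory GRing.Theory Num.Theory.
Local Open Scope ring_scope.

Local Notation Re := complex.Re.
Local Notation Im := complex.Im.

(** Let N be the number of pairs (w, z) such that w^p = 1 = z^q, both w and z lie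
in the open upper half plane, and (Re w)^2 + (Re z)^2 < 1.  The signature of the
knot is - 4 N, and its group has 2 N conjugacy classes of irreducible traceless
representations; together with alpha, the 2 N circles give 1 + 4 N generators.

Signature.  The loops of the Seifert surface form an array with p - 1 columns and
q - 1 rows, on which the Seifert form is minus the tensor product of two
unipotent bidiagonal forms ([torus_seifert_form]).  The symmetrized form is
diagonalized over C by the vectors with coordinates
(1 - w^(c+1)) (1 - z^(b+1)), for w^p = 1 = z^q and w, z <> 1; adding real and
imaginary parts of such a vector gives a real orthogonal basis, with norms
- 2 p q Re ((1 - w) (1 - conj z)) ([torus_form_orthogonal]).  It remains to sum
signs.  As p and q are odd, w and conj z can be replaced by their squares, and
the sign becomes that of Im w Im z Re (w z); adding the terms of z and conj z
leaves - 2 when (Re w Re z)^2 < (Im w Im z)^2, that is when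
(Re w)^2 + (Re z)^2 < 1, and 0 otherwise ([sum_sgz_unity_roots]).

Representations.  Let x_k be the images of the meridians at the bottom of the
braid, with k taken modulo p.  Passing q times through sigma_1 ... sigma_(p-1)
shows that the relations amount to x_k = P x_(k+q) P^-1, where
P = x_0 ... x_(q-1) ([strand_labels_pass]).  Then P^p commutes with all x_k, so
that P^p = s with s = 1 or s = -1 by Schur's lemma.  If u q = 1 modulo p, then
h = (s P)^u satisfies x_(k+1) = h^-1 x_k h, and g = s x_0 h^-1 satisfies g^q = 1
([torus_group_structure]).  Hence x_k = h^-k (s g h) h^k with g^q = 1 = h^p, and
any such s, g, h gives a representation ([torus_group_construction]).  It is
irreducible iff g and h do not commute, and traceless iff g h is.  The pair
(g, h) is determined up to conjugation by the eigenvalues z of g and w of h in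
the upper half plane: with h diagonal, tr (g h) = 0 prescribes the diagonal of g,
which leaves room for a non-zero entry off the diagonal iff
(Re w)^2 + (Re z)^2 < 1 ([traceless_pair_normal_form]).  The sign s, w and z can
be recovered from the representation ([torus_rep_inj]). *)

(** * Ranks of free abelian groups *)

Lemma free_of_rank_freeg (K : choiceType) (s : seq K) :
  uniq s -> (forall k, k \in s) -> free_of_rank {freeg K / int} (size s).
Proof.
move=> s_uniq s_full.
have s_inj : injective (tnth (in_tuple s)) by apply/tuple_uniqP.
have nthP k : exists i : 'I_(size s), tnth (in_tuple s) i = k.
  have lt_k : (index k s < size s)%N by rewrite index_mem.
  exists (Ordinal lt_k); rewrite (tnth_nth k) /= nth_index //.
pose e (i : 'I_(size s)) : {freeg K / int} := << tnth (in_tuple s) i >>.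
have coeffE (c : {ffun 'I_(size s) -> int}) j :
    coeff (tnth (in_tuple s) j) (\sum_i e i *~ c i) = c j.
  rewrite raddf_sum (bigD1 j) //= big1 ?addr0 => [|i ij].
    by rewrite /e freegU_mulz coeffU eqxx mulr1 intz.
  rewrite /e freegU_mulz coeffU (inj_eq s_inj) (negPf ij).
  by rewrite mulr0.
exists e => x; exists [ffun i => coeff (tnth (in_tuple s) i) x]; split.
  apply/eqP/freeg_eqP => k; have [j <-] := nthP k.
  by rewrite coeffE ffunE.
by move=> c ->; apply/ffunP => i; rewrite ffunE coeffE.
Qed.

(** Transports an enumeration of a classical set to the subtype that it defines, over
which the generators of the complex are built. *)
Lemma set_type_enum (T : choiceType) (S : set T) (s : seq T) :
    uniq s -> (forall x, S x <-> x \in s) ->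
  exists s' : seq (set_type S), [/\ uniq s', forall x, x \in s' & size s' = size s].
Proof.
move=> s_uniq sP; exists (pmap insub s); split.
- exact: pmap_sub_uniq.
- by move=> x; rewrite mem_pmap_sub; apply/sP/set_mem/valP.
- rewrite size_pmap_sub; apply/eqP; rewrite -all_count.
  by apply/allP => x /sP xS; apply/mem_set.
Qed.

(** * Signature of a diagonalized form *)

Section DiagonalForm.
Variable R : realType.

Lemma posdefmx_row_free k m (M : 'M[R]_m) (U : 'M[R]_(k, m)) :
  posdefmx (U *m M *m U^T) -> row_free U.
Proof.
move=> Upos; apply/inj_row_free => v vU0; apply/eqP; apply/negPn/negP => v_neq0.
by have := Upos v v_neq0; rewrite !mulmxA vU0 !mul0mx mxE ltxx.
Qed.

(** A vector in both row spaces would have positive and negative square, so the two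
spaces are independent. *)
Lemma posdefmx_negdefmx_dim k l m (M : 'M[R]_m) (U : 'M[R]_(k, m))
    (W : 'M[R]_(l, m)) :
  posdefmx (U *m M *m U^T) -> posdefmx (W *m - M *m W^T) -> (k + l <= m)%N.
Proof.
move=> Upos Wneg.
have /eqP rkU := posdefmx_row_free Upos.
have /eqP rkW := posdefmx_row_free Wneg.
have rk_add : (\rank (U + W)%MS <= m)%N by apply: rank_leq_col.
have := mxrank_sum_cap U W; rewrite rkU rkW.
suff /eqP -> : (U :&: W)%MS == 0 by rewrite mxrank0 addn0 => <-.
apply/rowV0P => v; rewrite sub_capmx => /andP[/submxP[a va] /submxP[b vb]].
apply/eqP/negPn/negP => v_neq0.
have a_neq0 : a != 0 by apply: contra_neq v_neq0 => a0; rewrite va a0 mul0mx.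
have b_neq0 : b != 0 by apply: contra_neq v_neq0 => b0; rewrite vb b0 mul0mx.
have := Upos a a_neq0; have := Wneg b b_neq0.
have quadE j (Z : 'M[R]_(j, m)) (M' : 'M[R]_m) (c : 'rV[R]_j) :
    c *m (Z *m M' *m Z^T) *m c^T = c *m Z *m M' *m (c *m Z)^T.
  by rewrite trmx_mul !mulmxA.
rewrite !quadE -va -vb mulmxN mulNmx mxE => lt1 lt2.
by have := addr_gt0 lt1 lt2; rewrite addNr ltxx.
Qed.

Variables (I : finType) (m : nat) (r : I -> 'rV[R]_m).

Lemma posdefmx_rows (M : 'M[R]_m) (d : I -> R) (P : pred I) :
    (forall i j, (r i *m M *m (r j)^T) 0 0 = d i *+ (i == j)) ->
    (forall i, P i -> 0 < d i) ->
  exists U : 'M[R]_(#|P|, m), posdefmx (U *m M *m U^T).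
Proof.
move=> rM dP; pose U := \matrix_(a < #|P|) r (enum_val a); exists U => u u_neq0.
have -> : U *m M *m U^T = diag_mx (\row_a d (enum_val a)).
  apply/matrixP => a b; rewrite [RHS]mxE [X in X *+ _]mxE -(inj_eq enum_val_inj) -rM.
  have entryE (A : 'M[R]_(#|P|, m)) (B : 'M[R]_(m, #|P|)) :
      (A *m B) a b = (row a A *m col b B) 0 0.
    by rewrite !mxE; apply: eq_bigr => c _; rewrite !mxE.
  by rewrite entryE row_mul rowK -tr_row rowK.
have term_ge0 a : 0 <= u 0 a ^+ 2 * d (enum_val a).
  by rewrite mulr_ge0 ?sqr_ge0 ?ltW //; apply/dP/(enum_valP a).
have -> : (u *m diag_mx (\row_a d (enum_val a)) *m u^T) 0 0
          = \sum_a u 0 a ^+ 2 * d (enum_val a).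
  rewrite mxE; apply: eq_bigr => a _; rewrite mul_mx_diag !mxE.
  by rewrite expr2 mulrAC.
rewrite lt_def sumr_ge0 // andbT psumr_neq0 //.
have /rV0Pn[a ua_neq0] := u_neq0; apply/hasP; exists a; first exact: mem_index_enum.
rewrite /= mulr_gt0 //; last exact/dP/(enum_valP a).
by rewrite lt_def sqr_ge0 sqrf_eq0 ua_neq0.
Qed.

Hypothesis card_I : #|I| = m.

(** The rows with positive square give the lower bound; the rows with negative square
span a negative definite space, which leaves no room for a larger one. *)
Lemma pos_index_diag (M : 'M[R]_m) (d : I -> R) :
    (forall i j, (r i *m M *m (r j)^T) 0 0 = d i *+ (i == j)) ->
    (forall i, d i != 0) ->
  pos_index M = #|[pred i | 0 < d i]|.
Proof.
move=> rM d_neq0; pose P := [pred i | 0 < d i]; rewrite -/P.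
have [U Upos] := posdefmx_rows (P := P) rM (fun i H => H).
have rN i j : (r i *m - M *m (r j)^T) 0 0 = - d i *+ (i == j).
  by rewrite mulmxN mulNmx mxE rM mulNrn.
have negP i : [predC P] i -> 0 < - d i.
  by rewrite /= oppr_gt0 lt_neqAle d_neq0 leNgt.
have [W Wneg] := posdefmx_rows rN negP.
have cardE : (#|P| + #|[predC P]|)%N = m.
  by rewrite cardC card_I.
apply/eqP; rewrite eqn_leq; apply/andP; split.
  apply/bigmax_leqP => k /asboolP[U' U'pos].
  by rewrite -(leq_add2r #|[predC P]|) cardE;
    apply: posdefmx_negdefmx_dim U'pos Wneg.
have lt_m : (#|P| < m.+1)%N by rewrite ltnS -cardE leq_addr.
apply: (leq_bigmax_cond (F := fun k : 'I_m.+1 => nat_of_ord k) (Ordinal lt_m)).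
by apply/asboolP; exists U.
Qed.

Lemma form_signature_diag (M : 'M[R]_m) (d : I -> R) :
    (forall i j, (r i *m M *m (r j)^T) 0 0 = d i *+ (i == j)) ->
    (forall i, d i != 0) ->
  form_signature M = \sum_i sgz (d i).
Proof.
move=> rM d_neq0; rewrite /form_signature (pos_index_diag rM d_neq0).
have rN i j : (r i *m - M *m (r j)^T) 0 0 = - d i *+ (i == j).
  by rewrite mulmxN mulNmx mxE rM mulNrn.
rewrite (pos_index_diag rN) => [|i]; last by rewrite oppr_eq0.
rewrite -!sum1_card ![in LHS]big_mkcond /= !(big_morph Posz PoszD (erefl 0%Z)).
rewrite [X in _ - X]big_mkcond -sumrB; apply: eq_bigr => i _; rewrite !inE oppr_gt0.
by case: (ltrgt0P (d i)) (d_neq0 i) => // [/gtr0_sgz -> | /ltr0_sgz ->].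
Qed.

End DiagonalForm.

(** * Roots of unity and signs *)

Section UnityRoots.
Variable C : numClosedFieldType.

(** The root 1 is left out because the eigenvector of the Seifert form that it would
index vanishes. *)
Definition nontrivial_unity_roots n : seq C :=
  [seq z <- sval (closed_field_poly_normal ('X^n - 1)) | z != 1].

Variable n : nat.
Hypothesis n_gt0 : (0 < n)%N.

Let all_roots := sval (closed_field_poly_normal ('X^n - 1 : {poly C})).

Let all_rootsE : 'X^n - 1 = \prod_(z <- all_roots) ('X - z%:P).
Proof.
rewrite /all_roots; case: closed_field_poly_normal => s /=.
by rewrite (monicP _) ?scale1r //; apply: monic_Xn_sub_1.
Qed.

Let mem_all_roots z : (z \in all_roots) = (z ^+ n == 1).
Proof. by rewrite -root_prod_XsubC -all_rootsE -unity_rootE. Qed.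

Let uniq_all_roots : uniq all_roots.
Proof.
rewrite -separable_prod_XsubC -all_rootsE separable_Xn_sub_1 //.
by rewrite pnatr_eq0 -lt0n.
Qed.

Lemma mem_nontrivial_unity_roots z :
  (z \in nontrivial_unity_roots n) = (z ^+ n == 1) && (z != 1).
Proof. by rewrite mem_filter mem_all_roots andbC. Qed.

Lemma uniq_nontrivial_unity_roots : uniq (nontrivial_unity_roots n).
Proof. exact: filter_uniq. Qed.

Lemma size_nontrivial_unity_roots : size (nontrivial_unity_roots n) = n.-1.
Proof.
have szr : size all_roots = n.
  have := size_prod_XsubC all_roots id.
  by rewrite -all_rootsE size_Xn_sub_1 // => -[].
rewrite /nontrivial_unity_roots -/all_roots.
rewrite -rem_filter // size_rem ?szr //.
by rewrite mem_all_roots expr1n.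
Qed.

End UnityRoots.

Section UnityRootCounts.
Variable R : rcfType.
Local Notation C := R[i].
Implicit Types z w : C.

Lemma unity_root_normsq n z : (0 < n)%N -> z ^+ n = 1 -> Re z ^+ 2 + Im z ^+ 2 = 1.
Proof.
move=> n_gt0 zn1; apply: (@complexI R); rewrite add_Re2_Im2 rmorph1.
have : `|z| ^+ n = 1 by rewrite -normrX zn1 normr1.
by move/eqP; rewrite pexpr_eq1 // => /eqP ->; rewrite expr1n.
Qed.

(** Squaring is a bijection on the n-th roots of unity for n odd. *)
Lemma odd_unity_root_sqrtK n z : odd n -> z ^+ n = 1 -> (z ^+ 2) ^+ uphalf n = z.
Proof. by move=> n_odd zn1; rewrite -exprM mul2n uphalfK n_odd exprS zn1 mulr1. Qed.

(** A purely imaginary z on the unit circle has z^2 = -1, hence z^(2n) = -1 for n odd.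
This is what makes the symmetrized Seifert form non-degenerate. *)
Lemma Re_odd_unity_root_neq0 n z : odd n -> z ^+ n = 1 -> Re z != 0.
Proof.
move=> n_odd zn1; apply/eqP => Rez0.
have := unity_root_normsq (odd_gt0 n_odd) zn1; rewrite Rez0 expr0n add0r => Imz2.
have z2 : z ^+ 2 = -1.
  case: z Rez0 Imz2 {zn1} => a b /= -> b2.
  by apply/eqP; rewrite eq_complex /= !(mul0r, mulr0, oppr0, addr0, sub0r) -expr2 b2 !eqxx.
have : (z ^+ n) ^+ 2 = -1 by rewrite exprAC z2 -signr_odd n_odd.
rewrite zn1 expr1n => /eqP; rewrite -subr_eq0 opprK -mulr2n pnatr_eq0 //.
Qed.

Lemma Im_odd_unity_root_neq0 n z : odd n -> z ^+ n = 1 -> z != 1 -> Im z != 0.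
Proof.
move=> n_odd zn1; apply: contra_neq => Imz0.
have := unity_root_normsq (odd_gt0 n_odd) zn1; rewrite Imz0 expr0n addr0 => Rez2.
have z2 : z ^+ 2 = 1.
  case: z Rez2 Imz0 {zn1} => a b /= a2 ->.
  by apply/eqP; rewrite eq_complex /= !(mul0r, mulr0, subr0, addr0) -expr2 a2 !eqxx.
by rewrite -(odd_unity_root_sqrtK n_odd zn1) z2 expr1n.
Qed.

Section OddOrder.
Variable n : nat.
Hypothesis n_odd : odd n.
Let n_gt0 := odd_gt0 n_odd.
Local Notation U := (nontrivial_unity_roots C n).

Lemma perm_conj_unity_roots : perm_eq (map conjc U) U.
Proof.
apply: uniq_perm; rewrite ?(map_inj_uniq (inv_inj (@conjcK _))) ?uniq_nontrivial_unity_roots //.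
move=> z; rewrite -[z in LHS]conjcK (mem_map (inv_inj (@conjcK _))).
have conj_eq1 w : (conjc w == 1) = (w == 1).
  by rewrite -[1 in LHS]conjc1 (inj_eq (inv_inj (@conjcK R))).
by rewrite !mem_nontrivial_unity_roots // -rmorphXn !conj_eq1.
Qed.

Lemma perm_sqr_unity_roots : perm_eq [seq z ^+ 2 | z <- U] U.
Proof.
have sqr_inU : {subset [seq z ^+ 2 | z <- U] <= U}.
  move=> _ /mapP[z + ->]; rewrite !mem_nontrivial_unity_roots // => /andP[/eqP zn1 z_neq1].
  rewrite exprAC zn1 expr1n eqxx; apply: contra_neq z_neq1 => z2.
  by rewrite -(odd_unity_root_sqrtK n_odd zn1) z2 expr1n.
have sqr_uniq : uniq [seq z ^+ 2 | z <- U].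
  rewrite map_inj_in_uniq ?uniq_nontrivial_unity_roots // => z w.
  rewrite !mem_nontrivial_unity_roots // => /andP[/eqP zn1 _] /andP[/eqP wn1 _] zw.
  by rewrite -(odd_unity_root_sqrtK n_odd zn1) zw odd_unity_root_sqrtK.
by apply: uniq_perm; rewrite ?uniq_nontrivial_unity_roots //;
  have [] := uniq_min_size sqr_uniq sqr_inU; rewrite ?size_map.
Qed.

Definition upper_unity_roots : seq C := [seq z <- U | 0 < Im z].

Lemma sum_conj_unity_roots (V : nmodType) (f : C -> V) :
  \sum_(z <- U) f (conjc z) = \sum_(z <- U) f z.
Proof. by rewrite -[RHS](perm_big _ perm_conj_unity_roots) /= big_map. Qed.

Lemma sum_sqr_unity_roots (V : nmodType) (f : C -> V) :
  \sum_(z <- U) f (z ^+ 2) = \sum_(z <- U) f z.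
Proof. by rewrite -[RHS](perm_big _ perm_sqr_unity_roots) /= big_map. Qed.

Lemma sum_upper_unity_roots (V : nmodType) (f : C -> V) :
    (forall z, f (conjc z) = f z) ->
  \sum_(z <- U) f z = (\sum_(z <- upper_unity_roots) f z) *+ 2.
Proof.
move=> f_even; rewrite [X in X *+ 2]big_filter mulr2n (bigID (fun z => 0 < Im z)) /=; congr (_ + _).
rewrite -(perm_big _ perm_conj_unity_roots) /= big_map.
rewrite big_seq_cond [RHS]big_seq_cond; apply: eq_big => [z|z _]; last exact: f_even.
case: (boolP (z \in U)) => //=; rewrite mem_nontrivial_unity_roots // => /andP[/eqP zn1 z1].
have := Im_odd_unity_root_neq0 n_odd zn1 z1.
by case: z {zn1 z1} => a b /= b0; rewrite oppr_gt0 -leNgt le_eqVlt eq_sym (negPf b0) orFb.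
Qed.

End OddOrder.

(** If |k| < |m| both terms have the sign of - m^2; if |k| > |m| then k - m and k + m have
the sign of k and the terms cancel. *)
Lemma sgz_mulB_add_mulD (m k : R) : `|m| != `|k| -> m != 0 ->
  sgz (m * (k - m)) + sgz (- m * (k + m)) = - (((`|k| < `|m|)%R : nat)%:Z *+ 2).
Proof.
move=> mk; have := mk; rewrite neq_lt => /orP[lt_mk|lt_km] m_neq0; last first.
  have k2 : k ^+ 2 < m ^+ 2 by rewrite -[k ^+ 2]real_normK ?num_real //
    -[m ^+ 2]real_normK ?num_real // ltr_pXn2r ?nnegrE.
  by rewrite lt_km !ltr0_sgz //; nra.
have m2 : m ^+ 2 < k ^+ 2 by rewrite -[k ^+ 2]real_normK ?num_real //
  -[m ^+ 2]real_normK ?num_real // ltr_pXn2r ?nnegrE.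
rewrite (ltNge `|k|) (ltW lt_mk) mul0rn oppr0 !sgzM sgzN mulNr -mulrBr.
have sgz_eq : sgz (k - m) = sgz (k + m).
  have : 0 < (k - m) * (k + m) by lra.
  move: (k - m) (k + m) => x y xy.
  have [x0|x0|x0] := ltrgt0P x; have [y0|y0|y0] := ltrgt0P y;
    rewrite ?(gtr0_sgz x0) ?(gtr0_sgz y0) ?(ltr0_sgz x0) ?(ltr0_sgz y0) //;
    exfalso; nra.
by rewrite sgz_eq subrr mulr0.
Qed.

Variables p q : nat.
Hypotheses (p_odd : odd p) (q_odd : odd q).

(** Counts the signs of the norms of the eigenvectors.  The pairs counted on the right
form orbits of size 4 under the conjugations of z and of w. *)
Lemma sum_sgz_unity_roots :
  \sum_(z <- nontrivial_unity_roots C p) \sum_(w <- nontrivial_unity_roots C q)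
     sgz (- Re ((1 - z) * (1 - conjc w)))
  = - (\sum_(z <- upper_unity_roots p) \sum_(w <- upper_unity_roots q)
        ((Re z ^+ 2 + Re w ^+ 2 < 1)%R : nat)%:Z) *+ 4.
Proof.
(* f is the summand after the substitution z -> z^2, w -> (conj w)^2:
   then 1 - z^2 = 2 Im z (Im z - i Re z), and likewise for w. *)
pose f z w : int := sgz (Im z * Im w * (Re z * Re w - Im z * Im w)).
pose g z w : int := ((Re z ^+ 2 + Re w ^+ 2 < 1)%R : nat)%:Z.
transitivity (\sum_(z <- nontrivial_unity_roots C p)
                \sum_(w <- nontrivial_unity_roots C q) f z w).
  rewrite -(sum_sqr_unity_roots p_odd); apply: eq_big_seq => z.
  rewrite mem_nontrivial_unity_roots ?odd_gt0 // => /andP[/eqP zp1 _].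
  rewrite -(sum_sqr_unity_roots q_odd) -(sum_conj_unity_roots q_odd).
  apply: eq_big_seq => w.
  rewrite mem_nontrivial_unity_roots ?odd_gt0 // => /andP[/eqP wq1 _].
  have := unity_root_normsq (odd_gt0 p_odd) zp1.
  have := unity_root_normsq (odd_gt0 q_odd) wq1.
  rewrite /f; case: z {zp1} => a b; case: w {wq1} => c d /= wn zn.
  set x := - _; have -> : x = 4 * (b * d * (a * c - b * d)).
    have bE : 1 - (a * a - b * b) = 2 * b * b by move: zn; rewrite !expr2; lra.
    have dE : 1 - (c * c - - d * - d) = 2 * d * d by move: wn; rewrite !expr2; lra.
    by rewrite /x bE dE; ring.
  by rewrite sgzM gtr0_sgz ?mul1r.
(* Pair the terms of w and conj w, with m = Im z Im w and k = Re z Re w. *)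
have sym : (\sum_(z <- nontrivial_unity_roots C p)
             \sum_(w <- nontrivial_unity_roots C q) f z w) *+ 2
   = - (\sum_(z <- nontrivial_unity_roots C p)
             \sum_(w <- nontrivial_unity_roots C q) g z w) *+ 2.
  rewrite -sumrN -!sumrMnl; apply: eq_big_seq => z.
  rewrite mem_nontrivial_unity_roots ?odd_gt0 // => /andP[/eqP zp1 z1].
  rewrite [LHS]mulr2n -{2}(sum_conj_unity_roots q_odd) -big_split -sumrN -sumrMnl.
  apply: eq_big_seq => w.
  rewrite mem_nontrivial_unity_roots ?odd_gt0 // => /andP[/eqP wq1 w1].
  have pq_odd : odd (p * q) by rewrite oddM p_odd.
  have zw1 : (z * w) ^+ (p * q) = 1.
    by rewrite exprMn exprM zp1 expr1n mulnC exprM wq1 expr1n mulr1.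
  have zw'1 : (z * conjc w) ^+ (p * q) = 1.
    by rewrite exprMn exprM zp1 expr1n mulnC exprM -rmorphXn wq1 rmorph1 expr1n mulr1.
  have := Re_odd_unity_root_neq0 pq_odd zw1.
  have := Re_odd_unity_root_neq0 pq_odd zw'1.
  have := Im_odd_unity_root_neq0 p_odd zp1 z1.
  have := Im_odd_unity_root_neq0 q_odd wq1 w1.
  have := unity_root_normsq (odd_gt0 p_odd) zp1.
  have := unity_root_normsq (odd_gt0 q_odd) wq1.
  rewrite /f /g; case: z {zp1 z1 zw1 zw'1} => a b; case: w {wq1 w1} => c d /=.
  move=> wn zn d0 b0 ne1 ne2.
  have m_neq0 : b * d != 0 by rewrite mulf_neq0.
  have ne_norm : `|b * d| != `|a * c|.
    apply/eqP => norm_eq; have : (b * d) ^+ 2 == (a * c) ^+ 2.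
      by rewrite -[(b * d) ^+ 2]real_normK ?num_real // norm_eq real_normK ?num_real.
    rewrite eqf_sqr => /orP[] /eqP E.
      by move: ne2; rewrite E subrr eqxx.
    by move: ne1; rewrite mulrN opprK E addrN eqxx.
  transitivity (sgz (b * d * (a * c - b * d)) + sgz (- (b * d) * (a * c + b * d))).
    by congr (_ + sgz _); ring.
  rewrite sgz_mulB_add_mulD // -mulNrn; congr (- (nat_of_bool _)%:Z *+ _).
  rewrite -(ltr_pXn2r (n := 2)) ?nnegrE // !real_normK ?num_real //.
  by apply/idP/idP; nra.
have -> : \sum_(z <- nontrivial_unity_roots C p)
            \sum_(w <- nontrivial_unity_roots C q) f z w
  = - (\sum_(z <- nontrivial_unity_roots C p)
             \sum_(w <- nontrivial_unity_roots C q) g z w).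
  by apply/eqP; rewrite -(eqr_pMn2r (n := 2)) // sym.
rewrite (sum_upper_unity_roots p_odd); last first.
  by move=> [a b]; apply: eq_bigr.
under eq_bigr => z _.
  rewrite (sum_upper_unity_roots q_odd); last by move=> [a b].
  over.
by rewrite sumrMnl -mulrnA mulNrn.
Qed.

End UnityRootCounts.

(** * The Seifert form of a torus braid *)

Section TorusBraid.
Variables n q : nat.
Local Notation T := (torus_braid n.+1 q).

Lemma size_torus_braid : size T = (q * n)%N.
Proof.
rewrite size_flatten /shape map_nseq size_map size_enum_ord.
by rewrite sumn_nseq mulnC.
Qed.

Lemma nth_torus_braid x0 t : (t < q * n)%N ->
  nat_of_ord (nth x0 T t).1 = (t %% n)%N /\ (nth x0 T t).2 = true.
Proof.
rewrite /torus_braid; elim: q t => [|m IHm] t //=; rewrite mulSn nth_cat => lt_t.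
rewrite size_map size_enum_ord; case: ltnP => [lt_tn|le_nt].
  rewrite (nth_map x0.1) ?size_enum_ord //= nth_enum_ord // modn_small //.
have {}lt_t : (t - n < m * n)%N by rewrite ltn_subLR.
by have [-> ->] := IHm _ lt_t; rewrite -{2}(subnKC le_nt) modnDl.
Qed.

Lemma tnth_torus_braid (t : 'I_(size T)) :
  nat_of_ord (tnth (in_tuple T) t).1 = (t %% n)%N /\ (tnth (in_tuple T) t).2 = true.
Proof.
rewrite (tnth_nth (tnth (in_tuple T) t)); apply: nth_torus_braid.
by rewrite -size_torus_braid.
Qed.

(** The generators occur in cyclic order along the word, so that two consecutive
occurrences of the same one are n letters apart. *)
Lemma mem_torus_loops (x : 'I_(size T) * 'I_(size T)) :
  (x \in seifert_loops T) = (nat_of_ord x.2 == x.1 + n)%N.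
Proof.
rewrite inE; case: x => s t /=.
have [-> _] := tnth_torus_braid s; have [-> _] := tnth_torus_braid t.
have n_gt0 : (0 < n)%N.
  by have := leq_ltn_trans (leq0n s) (ltn_ord s); rewrite size_torus_braid muln_gt0 => /andP[].
apply/idP/eqP => [/and3P[lt_st /eqP eq_st /forallP no_u]|tE].
  have le_t : (s + n <= t)%N.
    have /dvdnP[k kE] : (n %| t - s)%N by rewrite -eqn_mod_dvd ?(ltnW lt_st) // eq_st.
    have tE : t = (s + k * n)%N :> nat by rewrite -kE subnKC // ltnW.
    case: k tE {kE} => [|k] tE; first by rewrite tE mul0n addn0 ltnn in lt_st.
    by rewrite tE mulSn addnA leq_addr.
  apply/eqP; rewrite eqn_leq le_t andbT leqNgt; apply/negP => lt_t.
  have := no_u (Ordinal (ltn_trans lt_t (ltn_ord t))).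
  have [-> _] := tnth_torus_braid (Ordinal (ltn_trans lt_t (ltn_ord t))) => /=.
  by rewrite lt_t modnDr eqxx; lia.
rewrite tE modnDr eqxx /=; apply/andP; split; first lia.
apply/forallP => u; have [-> _] := tnth_torus_braid u; apply/implyP => /andP[lt_su lt_ut].
apply/negP => /eqP /esym eq_su.
have : (n %| u - s)%N by rewrite -eqn_mod_dvd ?(ltnW lt_su) // eq_su.
move/dvdn_leq; rewrite subn_gt0 lt_su => /(_ isT).
by rewrite leqNgt ltn_subLR ?(ltnW lt_su) // lt_ut.
Qed.

End TorusBraid.

(** Positions in the word are ordered lexicographically by row and column. *)
Lemma ltn_lex (n b c b' c' : nat) : (c < n)%N -> (c' < n)%N ->
  (b * n + c < b' * n + c')%N = (b < b')%N || (b == b') && (c < c')%N.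
Proof.
move=> cn c'n; case: (ltngtP b b') => [lt_b|lt_b|->] /=; last by rewrite ltn_add2l.
  have : (b.+1 * n <= b' * n)%N by rewrite leq_mul2r lt_b orbT.
  rewrite mulSn; lia.
have : (b'.+1 * n <= b * n)%N by rewrite leq_mul2r lt_b orbT.
rewrite mulSn; lia.
Qed.

Lemma eqn_lex (n b c b' c' : nat) : (c < n)%N -> (c' < n)%N ->
  (b * n + c == b' * n + c')%N = (b == b') && (c == c').
Proof.
move=> cn c'n; rewrite eqn_leq (leqNgt (b * n + c)%N) (leqNgt (b' * n + c')%N).
by rewrite (ltn_lex _ _ c'n cn) (ltn_lex _ _ cn c'n); case: (ltngtP b b'); case: (ltngtP c c').
Qed.

Section TorusSeifertForm.
Variables (R : realType) (n q : nat).
Local Notation T := (torus_braid n.+1 q).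

(** The loop of column c and row b traverses the bands b n + c and (b + 1) n + c.  The
right-hand side is minus the tensor product of the forms of matrices 1 - L and
1 - L^T, with L the lower shift matrix. *)
Lemma torus_seifert_form (x y : 'I_(size T) * 'I_(size T)) (c b c' b' : nat) :
    (c < n)%N -> (c' < n)%N ->
    nat_of_ord x.1 = (b * n + c)%N -> nat_of_ord x.2 = (b.+1 * n + c)%N ->
    nat_of_ord y.1 = (b' * n + c')%N -> nat_of_ord y.2 = (b'.+1 * n + c')%N ->
  seifert_form R x y
  = - (((c == c')%:R - (c == c'.+1)%:R) * ((b == b')%:R - (b' == b.+1)%:R)).
Proof.
case: x y => x1 x2 [y1 y2] /= cn c'n x1E x2E y1E y2E.
rewrite /seifert_form xpair_eqE /=.
have [-> ->] := tnth_torus_braid x1; have [_ ->] := tnth_torus_braid x2.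
have [-> _] := tnth_torus_braid y1.
rewrite -!val_eqE /= x1E x2E y1E y2E !modnMDl !modn_small // !eqn_lex // !ltn_lex //.
rewrite !eqSS !ltnS if_same.
have [->|neq_c] := eqVneq c c'.
  rewrite (ltn_eqF (ltnSn c')) !andbT andbb.
  have [->|neq_b] := eqVneq b b'.
    by rewrite (ltn_eqF (ltnSn b')) /=; field.
  by rewrite [b' == _]eq_sym; case: eqP => _ /=; ring.
rewrite !andbF /=; have [->|_] := eqVneq c c'.+1; last by rewrite /=; ring.
rewrite ltnSn (ltnNge c'.+1) leqnSn /= !andbT !andbF !orbF.
have [->|neq_b] := eqVneq b b'.
  by rewrite ltnn leqnn (ltn_eqF (ltnSn b')) /=; ring.
have [->|neq_b'] := eqVneq b' b.+1.
  by rewrite ltnSn leqnSn (ltnNge b.+1) leqnSn /= orbT /=; ring.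
by rewrite !orbF; case: (ltngtP b b') => //= _; ring.
Qed.

Lemma torus_loop_bound c b : (c < n)%N -> (b < q.-1)%N -> (b.+1 * n + c < size T)%N.
Proof.
move=> cn bq; rewrite size_torus_braid.
have : (b.+2 * n <= q * n)%N by rewrite leq_mul2r; apply/orP; right; lia.
by rewrite [b.+2]lock mulSn -lock mulSn; lia.
Qed.

Lemma torus_loop_bound1 c b : (c < n)%N -> (b < q.-1)%N -> (b * n + c < size T)%N.
Proof.
by move=> cn bq; apply: leq_ltn_trans (torus_loop_bound cn bq); rewrite mulSn -addnA leq_addl.
Qed.

Definition torus_loop (u : 'I_n * 'I_q.-1) : 'I_(size T) * 'I_(size T) :=
  (Ordinal (torus_loop_bound1 (ltn_ord u.1) (ltn_ord u.2)),
   Ordinal (torus_loop_bound (ltn_ord u.1) (ltn_ord u.2))).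

Lemma torus_loop_inj : injective torus_loop.
Proof.
move=> [c b] [c' b'] [E _]; have /eqP := E; rewrite eqn_lex // => /andP[/eqP bE /eqP cE].
by congr (_, _); apply: val_inj.
Qed.

Lemma torus_loops_imset : seifert_loops T = torus_loop @: [set: 'I_n * 'I_q.-1].
Proof.
apply/setP => x; rewrite mem_torus_loops; apply/eqP/imsetP => [|[[c b] _ ->] /=]; last first.
  by rewrite mulSn -addnA addnC.
case: x => s t /= tE.
have lt_t : (t < q * n)%N by rewrite -[X in (_ < X)%N]size_torus_braid.
have n_gt0 : (0 < n)%N by have := leq_ltn_trans (leq0n t) lt_t; rewrite muln_gt0 => /andP[].
have cn : (s %% n < n)%N by rewrite ltn_mod.
have bq : (s %/ n < q.-1)%N.
  have : (t %/ n < q)%N by rewrite ltn_divLR.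
  by rewrite tE divnDr // divnn n_gt0 addn1; lia.
exists (Ordinal cn, Ordinal bq); first by rewrite finset.in_setT.
apply: injective_projections; apply: val_inj => /=.
  by rewrite -divn_eq.
by rewrite mulSn -addnA -divn_eq tE addnC.
Qed.

Lemma sum_torus_loops (V : nmodType) (F : 'I_(size T) * 'I_(size T) -> V) :
  \sum_(x in seifert_loops T) F x = \sum_(c < n) \sum_(b < q.-1) F (torus_loop (c, b)).
Proof.
rewrite torus_loops_imset big_imset /=; last by move=> u v _ _; apply: torus_loop_inj.
by rewrite pair_bigA /=; apply: eq_big => [u|[] //]; apply: finset.in_setT.
Qed.

Lemma card_torus_loops : #|seifert_loops T| = (n * q.-1)%N.
Proof.
by rewrite torus_loops_imset (card_imset _ torus_loop_inj) cardsT card_prod !card_ord.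
Qed.

(** A function of column and row, as a vector in the basis of loops. *)
Definition torus_row (f : nat -> nat -> R) : 'rV[R]_#|seifert_loops T| :=
  \row_(a < #|seifert_loops T|)
    f (nat_of_ord (enum_val a).1 %% n)%N (nat_of_ord (enum_val a).1 %/ n)%N.

(** The negative of the Seifert form on functions of column and row; the ring is a
parameter because the eigenvectors are complex. *)
Definition bidiag_form (V : pzRingType) (f g : nat -> nat -> V) : V :=
  \sum_(c < n) \sum_(b < q.-1) \sum_(c' < n) \sum_(b' < q.-1)
    f c b * (((c == c' :> nat)%:R - (c == c'.+1 :> nat)%:R)
             * ((b == b' :> nat)%:R - (b' == b.+1 :> nat)%:R)) * g c' b'.

Lemma torus_seifert_matrix (f g : nat -> nat -> R) :
  (torus_row f *m seifert_matrix R T *m (torus_row g)^T) 0 0 = - bidiag_form f g.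
Proof.
rewrite mxE.
transitivity (\sum_(x in seifert_loops T) \sum_(y in seifert_loops T)
  f (x.1 %% n)%N (x.1 %/ n)%N * seifert_form R x y * g (y.1 %% n)%N (y.1 %/ n)%N).
  rewrite exchange_big /= [RHS]big_enum_val; apply: eq_bigr => j _.
  rewrite !mxE mulr_suml [RHS]big_enum_val; apply: eq_bigr => i _.
  by rewrite !mxE.
rewrite sum_torus_loops -sumrN; apply: eq_bigr => c _; rewrite -sumrN; apply: eq_bigr => b _.
rewrite sum_torus_loops -sumrN; apply: eq_bigr => c' _; rewrite -sumrN; apply: eq_bigr => b' _.
rewrite (torus_seifert_form (c := c) (b := b) (c' := c') (b' := b')) //= mulrN mulNr.
have modE (i : 'I_n) j : ((j * n + i) %% n)%N = i by rewrite modnMDl modn_small.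
have divE (i : 'I_n) j : ((j * n + i) %/ n)%N = j.
  by rewrite divnMDl ?divn_small ?addn0 //; apply: leq_ltn_trans (ltn_ord i).
by rewrite !modE !divE.
Qed.

End TorusSeifertForm.

(** * Diagonalization of the Seifert form *)

Section CyclotomicEigenvectors.
Variable F : fieldType.
Implicit Types z w : F.

Lemma geometric_sum_unity m z : z ^+ m = 1 -> \sum_(c < m) z ^+ c = m%:R * (z == 1)%:R.
Proof.
move=> zm1; have [->|z_neq1] := eqVneq z 1.
  under eq_bigr do rewrite expr1n.
  by rewrite sumr_const card_ord mulr1.
rewrite mulr0; apply/eqP; have := subrX1 z m; rewrite zm1 subrr => /esym/eqP.
by rewrite mulf_eq0 subr_eq0 (negPf z_neq1).
Qed.

(** The inner sum telescopes to (1 - w) (w^c - z (z w)^c).  The term c = m of the outer sum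
vanishes, and adding it produces geometric sums over all powers, of which only that of
z w can survive. *)
Lemma bidiag_sum m z w :
  z ^+ m.+1 = 1 -> w ^+ m.+1 = 1 -> w != 1 ->
  \sum_(c < m) \sum_(d < m)
    (1 - z ^+ c.+1) * ((c == d :> nat)%:R - (c == d.+1 :> nat)%:R) * (1 - w ^+ d.+1)
  = m.+1%:R * (1 - z) * (z * w == 1)%:R.
Proof.
move=> zm1 wm1 w_neq1.
have inner (c : 'I_m) : \sum_(d < m)
    (1 - z ^+ c.+1) * ((c == d :> nat)%:R - (c == d.+1 :> nat)%:R) * (1 - w ^+ d.+1)
    = (1 - w) * (w ^+ c - z * (z * w) ^+ c).
  have pickE (j : nat) (f : nat -> F) : (j <= m)%N ->
      \sum_(d < m) (j == d :> nat)%:R * f d = (j < m)%N%:R * f j.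
    move=> le_jm; have [lt_jm|] := ltnP j m.
      rewrite (bigD1 (Ordinal lt_jm)) //= eqxx big1 ?addr0 ?mul1r // => d.
      by rewrite -val_eqE /= eq_sym => /negPf ->; rewrite mul0r.
    move=> le_mj; rewrite big1 ?mul0r // => d _.
    by rewrite gtn_eqF ?mul0r //; apply: leq_trans le_mj.
  transitivity ((1 - z ^+ c.+1) * (\sum_(d < m) (c == d :> nat)%:R * (1 - w ^+ d.+1)
       - \sum_(d < m) (c == d.+1 :> nat)%:R * (1 - w ^+ d.+1))).
    rewrite -sumrB big_distrr /=; apply: eq_bigr => d _.
    ring.
  rewrite (pickE c (fun d => 1 - w ^+ d.+1)) ?(ltnW (ltn_ord c)) // ltn_ord mul1r.
  have -> : \sum_(d < m) (c == d.+1 :> nat)%:R * (1 - w ^+ d.+1) = 1 - w ^+ c.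
    case: c => -[|c] lt_c /=.
      by rewrite expr0 subrr big1 // => d _; rewrite mul0r.
    under eq_bigr do rewrite eqSS.
    by rewrite (pickE c (fun d => 1 - w ^+ d.+1)) ?(ltnW (ltnW lt_c)) // (ltnW lt_c) mul1r.
  by rewrite exprMn !exprS; ring.
under eq_bigr do rewrite inner.
have -> : \sum_(c < m) (1 - w) * (w ^+ c - z * (z * w) ^+ c)
        = \sum_(c < m.+1) (1 - w) * (w ^+ c - z * (z * w) ^+ c).
  rewrite big_ord_recr /= exprMn mulrA -exprS zm1 mul1r subrr mulr0 addr0 //.
rewrite -big_distrr /= sumrB -big_distrr /= geometric_sum_unity // (negPf w_neq1).
rewrite geometric_sum_unity ?exprMn ?zm1 ?wm1 ?mulr1 //.
have [zw1|_] := eqVneq (z * w) 1; rewrite /= ?mulr0 ?mul0r; last by ring.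
transitivity (m.+1%:R * (z * w - z)); first by ring.
by rewrite zw1 /=; ring.
Qed.

End CyclotomicEigenvectors.

Section TorusSignature.
Variables (R : realType) (n q : nat).
Local Notation C := R[i].
Local Notation T := (torus_braid n.+1 q).
Local Notation Up := (nontrivial_unity_roots C n.+1).
Local Notation Uq := (nontrivial_unity_roots C q).
Local Notation toC := (real_complex R).
Hypothesis q_gt0 : (0 < q)%N.

Lemma bidiag_formDl (f1 f2 g : nat -> nat -> C) (k1 k2 : C) :
  bidiag_form n q (fun c b => k1 * f1 c b + k2 * f2 c b) g
  = k1 * bidiag_form n q f1 g + k2 * bidiag_form n q f2 g.
Proof.
rewrite /bidiag_form 2!big_distrr -big_split; apply: eq_bigr => c _.
rewrite 2!big_distrr -big_split; apply: eq_bigr => b _.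
rewrite 2!big_distrr -big_split; apply: eq_bigr => c' _.
rewrite 2!big_distrr -big_split; apply: eq_bigr => b' _ /=; ring.
Qed.

Lemma bidiag_formDr (f g1 g2 : nat -> nat -> C) (k1 k2 : C) :
  bidiag_form n q f (fun c b => k1 * g1 c b + k2 * g2 c b)
  = k1 * bidiag_form n q f g1 + k2 * bidiag_form n q f g2.
Proof.
rewrite /bidiag_form 2!big_distrr -big_split; apply: eq_bigr => c _.
rewrite 2!big_distrr -big_split; apply: eq_bigr => b _.
rewrite 2!big_distrr -big_split; apply: eq_bigr => c' _.
rewrite 2!big_distrr -big_split; apply: eq_bigr => b' _ /=; ring.
Qed.

Lemma bidiag_form_real (f g : nat -> nat -> R) :
  toC (bidiag_form n q f g)
  = bidiag_form n q (fun c b => toC (f c b)) (fun c b => toC (g c b)).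
Proof.
rewrite /bidiag_form rmorph_sum; apply: eq_bigr => c _.
rewrite rmorph_sum; apply: eq_bigr => b _; rewrite rmorph_sum; apply: eq_bigr => c' _.
rewrite rmorph_sum; apply: eq_bigr => b' _ /=.
by rewrite !rmorphM !rmorphB !rmorph_nat.
Qed.

(** The kernel of A - lambda A^T, for A a bidiagonal factor of the Seifert form, is
spanned by such a vector in one variable. *)
Definition eigen_fun (z w : C) (c b : nat) : C := (1 - z ^+ c.+1) * (1 - w ^+ b.+1).

(** The sum Re + Im, unlike Re alone, does not identify conjugate eigenvectors. *)
Definition real_eigen_fun (z w : C) (c b : nat) : R :=
  Re (eigen_fun z w c b) + Im (eigen_fun z w c b).

Lemma conj_eigen_fun z w c b :
  eigen_fun (conjc z) (conjc w) c b = conjc (eigen_fun z w c b).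
Proof. by rewrite /eigen_fun rmorphM !rmorphB !rmorphXn !rmorph1. Qed.

Lemma real_eigen_funE z w :
  (fun c b => toC (real_eigen_fun z w c b))
  = (fun c b => ((1 - 'i) / 2) * eigen_fun z w c b
              + ((1 + 'i) / 2) * eigen_fun (conjc z) (conjc w) c b).
Proof.
apply/funext => c; apply/funext => b; rewrite conj_eigen_fun /real_eigen_fun.
case: (eigen_fun z w c b) => x y; rewrite rmorphD /=.
have -> : Complex x y = toC x + 'i * toC y by rewrite -complexiE; exact: (complexE (Complex x y)).
have -> : Complex x (- y) = toC x - 'i * toC y.
  by rewrite -mulrN -rmorphN -complexiE; exact: (complexE (Complex x (- y))).
transitivity (toC x - 'i ^+ 2 * toC y); first by rewrite sqrCi mulN1r opprK.
by field.
Qed.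

Lemma bidiag_form_eigen z w z' w' :
    z ^+ n.+1 = 1 -> z' ^+ n.+1 = 1 -> z' != 1 -> w ^+ q = 1 -> w' ^+ q = 1 -> w != 1 ->
  bidiag_form n q (eigen_fun z w) (eigen_fun z' w')
  = (n.+1%:R * (1 - z) * (z * z' == 1)%:R) * (q%:R * (1 - w') * (w' * w == 1)%:R).
Proof.
move=> zp z'p z'1 wq w'q w1; rewrite -(bidiag_sum zp z'p z'1).
have qE : q.-1.+1 = q by apply: prednK.
have := @bidiag_sum _ q.-1 w' w; rewrite qE => <- //.
rewrite /bidiag_form mulr_suml; apply: eq_bigr => c _.
rewrite mulr_suml exchange_big; apply: eq_bigr => c' _.
rewrite mulr_sumr exchange_big; apply: eq_bigr => b' _.
rewrite mulr_sumr; apply: eq_bigr => b _ /=.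
by rewrite /eigen_fun [(b' == b :> nat)]eq_sym; ring.
Qed.

(** The square of a real eigenvector for the symmetrized Seifert form. *)
Definition eigen_norm (z w : C) : R :=
  - (n.+1%:R * q%:R * 2 * Re ((1 - z) * (1 - conjc w))).

(** The change of basis from a vector v and its conjugate to Re v + Im v has coefficients
k = (1 - i) / 2 and k' = (1 + i) / 2, with k^2 + k'^2 = 0 and 2 k k' = 1.  Hence e1,
with coefficients k^2 and k'^2, cancels, and e2, with coefficient 2 k k', remains. *)
Lemma cas_polarization (N e1 e2 b b' b1 b1' b2 b2' b3 b3' : C) :
    b + b' = - N * e1 -> b1 + b1' = - N * e2 ->
    b2 + b2' = - N * e2 -> b3 + b3' = - N * e1 ->
  - ((1 - 'i) / 2 * ((1 - 'i) / 2 * b + (1 + 'i) / 2 * b2)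
     + (1 + 'i) / 2 * ((1 - 'i) / 2 * b1 + (1 + 'i) / 2 * b3)
     + ((1 - 'i) / 2 * ((1 - 'i) / 2 * b' + (1 + 'i) / 2 * b1')
        + (1 + 'i) / 2 * ((1 - 'i) / 2 * b2' + (1 + 'i) / 2 * b3'))) = N * e2.
Proof.
move=> S S1 S2 S3.
transitivity (- (((1 - 'i) / 2) ^+ 2 * (b + b') + ((1 + 'i) / 2) ^+ 2 * (b3 + b3')
                 + (1 - 'i) / 2 * ((1 + 'i) / 2) * ((b1 + b1') + (b2 + b2')))).
  by ring.
rewrite S S1 S2 S3.
transitivity (N * (e1 * (1 + 'i ^+ 2) / 2 + e2 * (1 - 'i ^+ 2) / 2)); first by field.
by rewrite sqrCi; field.
Qed.

Lemma mem_unity_rootsE m z : (0 < m)%N -> z \in nontrivial_unity_roots C m ->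
  [/\ z ^+ m = 1, z != 1, conjc z ^+ m = 1, conjc z != 1 &
      forall z', (z * z' == 1) = (z' == conjc z)].
Proof.
move=> m_gt0; rewrite mem_nontrivial_unity_roots // => /andP[/eqP zm1 z_neq1].
have conj1 : conjc z * z = 1.
  case: z zm1 (unity_root_normsq m_gt0 zm1) {z_neq1} => a b _ /= ab1.
  apply/eqP; rewrite eq_complex /= mulNr opprK -!expr2 ab1 eqxx /=.
  by rewrite addrC mulNr [b * a]mulrC addNr.
split=> //.
- by rewrite -rmorphXn zm1 rmorph1.
- by apply: contra_neq z_neq1 => z1; rewrite -[z]conjcK z1 conjc1.
have z_neq0 : z != 0 by apply: contraTneq (oner_neq0 C) => z0; rewrite -conj1 z0 mulr0 eqxx.
by move=> z'; rewrite -conj1 [conjc z * z]mulrC (inj_eq (mulfI z_neq0)).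
Qed.

(** Bilinearly, an eigenvector pairs only with its conjugate. *)
Lemma symmetrized_bidiag_form_eigen z w z' w' :
    z \in Up -> w \in Uq -> z' \in Up -> w' \in Uq ->
  bidiag_form n q (eigen_fun z w) (eigen_fun z' w')
    + bidiag_form n q (eigen_fun z' w') (eigen_fun z w)
  = - toC (eigen_norm z w) * ((z' == conjc z) && (w' == conjc w))%:R.
Proof.
move=> /(mem_unity_rootsE (ltn0Sn n))[zp z1 czp cz1 zE].
move=> /(mem_unity_rootsE q_gt0)[wq w1 cwq cw1 wE].
move=> /(mem_unity_rootsE (ltn0Sn n))[z'p z'1 _ _ z'E].
move=> /(mem_unity_rootsE q_gt0)[w'q w'1 _ _ w'E].
rewrite !bidiag_form_eigen // [z' * z]mulrC [w' * w]mulrC zE wE.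
have [->|_] := eqVneq z' (conjc z); last by rewrite !(mulr0, mul0r) addr0.
have [->|_] := eqVneq w' (conjc w); last by rewrite !(mulr0, mul0r) addr0.
rewrite /= !mulr1 /eigen_norm rmorphN opprK !rmorphM !rmorph_nat /=.
have E : (1 - z) * (1 - conjc w) + (1 - conjc z) * (1 - w) = 2 * toC (Re ((1 - z) * (1 - conjc w))).
  rewrite -addcJ; congr (_ + _).
  by rewrite rmorphM !rmorphB rmorph1 /= conjcK.
transitivity (n.+1%:R * q%:R * ((1 - z) * (1 - conjc w) + (1 - conjc z) * (1 - w))).
  by ring.
by rewrite E; ring.
Qed.

Lemma conj_unity_root m z : (0 < m)%N -> z \in nontrivial_unity_roots C m ->
  conjc z \in nontrivial_unity_roots C m.
Proof.
move=> m_gt0 /(mem_unity_rootsE m_gt0)[_ _ cz cz1 _].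
by rewrite mem_nontrivial_unity_roots // cz eqxx.
Qed.

Lemma eigen_norm_conj z w : eigen_norm (conjc z) (conjc w) = eigen_norm z w.
Proof.
rewrite /eigen_norm; congr (- (_ * _)).
have -> : (1 - conjc z) * (1 - conjc (conjc w)) = conjc ((1 - z) * (1 - conjc w)).
  by rewrite rmorphM !rmorphB rmorph1.
by case: ((1 - z) * _).
Qed.

Lemma torus_form_orthogonal z w z' w' : z \in Up -> w \in Uq -> z' \in Up -> w' \in Uq ->
  (torus_row n q (real_eigen_fun z w)
     *m (seifert_matrix R T + (seifert_matrix R T)^T) *m (torus_row n q (real_eigen_fun z' w'))^T) 0 0
  = eigen_norm z w *+ ((z == z') && (w == w')).
Proof.
move=> zU wU z'U w'U.
have czU := conj_unity_root (ltn0Sn n) zU; have cwU := conj_unity_root q_gt0 wU.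
have cz'U := conj_unity_root (ltn0Sn n) z'U; have cw'U := conj_unity_root q_gt0 w'U.
set f := real_eigen_fun z w; set g := real_eigen_fun z' w'.
have -> : (torus_row n q f *m (seifert_matrix R T + (seifert_matrix R T)^T) *m (torus_row n q g)^T) 0 0
    = - (bidiag_form n q f g + bidiag_form n q g f).
  rewrite mulmxDr mulmxDl mxE torus_seifert_matrix opprD; congr (_ + _).
  by rewrite -torus_seifert_matrix -[RHS]trace_mx11 -mxtrace_tr !trmx_mul trmxK mulmxA trace_mx11.
apply: (@complexI R); rewrite rmorphN rmorphD rmorphMn /= !bidiag_form_real.
rewrite !real_eigen_funE !(bidiag_formDl, bidiag_formDr).
have S := symmetrized_bidiag_form_eigen zU wU z'U w'U.
have S1 := symmetrized_bidiag_form_eigen czU cwU z'U w'U.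
have S2 := symmetrized_bidiag_form_eigen zU wU cz'U cw'U.
have S3 := symmetrized_bidiag_form_eigen czU cwU cz'U cw'U.
rewrite !conjcK !eigen_norm_conj in S1 S2 S3.
have inj := inj_eq (inv_inj (@conjcK R)).
have swap (x y : C) : (conjc x == y) = (x == conjc y).
  exact: can2_eq (@conjcK R) (@conjcK R) x y.
rewrite !inj in S2; rewrite !swap in S3.
rewrite [z == z']eq_sym [w == w']eq_sym -[RHS]mulr_natr.
set e1 : C := ((z' == conjc z) && _)%:R in S S3; set e2 : C := (_ && _)%:R in S1 S2 *.
set N := toC _ in S S1 S2 S3 *.
exact: (cas_polarization S S1 S2 S3).
Qed.

(** In terms of square roots z0 and w0 of z and conj w, the norm is a multiple of
Im z0 Im w0 Re (z0 w0). *)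
Lemma eigen_norm_neq0 z w : odd n.+1 -> odd q -> z \in Up -> w \in Uq -> eigen_norm z w != 0.
Proof.
move=> p_odd q_odd zU wU; rewrite oppr_eq0 !mulf_neq0 ?pnatr_eq0 -?lt0n //.
have := zU; rewrite -(perm_mem (perm_sqr_unity_roots R p_odd)) => /mapP[z0 z0U ->].
have := conj_unity_root q_gt0 wU.
rewrite -(perm_mem (perm_sqr_unity_roots R q_odd)) => /mapP[w0 w0U ->].
move: z0U w0U; rewrite !mem_nontrivial_unity_roots // => /andP[/eqP z0p z01] /andP[/eqP w0q w01].
have zw1 : (z0 * w0) ^+ (n.+1 * q) = 1.
  by rewrite exprMn exprM z0p expr1n mulnC exprM w0q expr1n mulr1.
have := Re_odd_unity_root_neq0 (_ : odd (n.+1 * q)) zw1; rewrite oddM p_odd q_odd => /(_ isT).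
have := Im_odd_unity_root_neq0 p_odd z0p z01; have := Im_odd_unity_root_neq0 q_odd w0q w01.
have := unity_root_normsq (odd_gt0 p_odd) z0p; have := unity_root_normsq (odd_gt0 q_odd) w0q.
case: z0 {z0p z01 zw1} => a b; case: w0 {w0q w01} => c d /= wn zn d0 b0 re0.
set x := (X in X != 0); have -> : x = -4 * (b * d * (a * c - b * d)).
  have bE : 1 - (a * a - b * b) = 2 * b * b by move: zn; rewrite !expr2; lra.
  have dE : 1 - (c * c - d * d) = 2 * d * d by move: wn; rewrite !expr2; lra.
  by rewrite /x bE dE; ring.
by rewrite !mulf_neq0 // oppr_eq0 pnatr_eq0.
Qed.

Lemma torus_link_signature : odd n.+1 -> odd q ->
  link_signature R T
  = - (\sum_(z <- upper_unity_roots R n.+1) \sum_(w <- upper_unity_roots R q)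
        ((Re z ^+ 2 + Re w ^+ 2 < 1)%R : nat)%:Z) *+ 4.
Proof.
move=> p_odd q_odd; rewrite -sum_sgz_unity_roots //.
pose I : finType := ('I_(size Up) * 'I_(size Uq))%type.
pose zeta (i : I) := tnth (in_tuple Up) i.1; pose eta (i : I) := tnth (in_tuple Uq) i.2.
have zetaU i : zeta i \in Up by exact: mem_tnth.
have etaU i : eta i \in Uq by exact: mem_tnth.
have card_I : #|I| = #|seifert_loops T|.
  by rewrite card_prod !card_ord card_torus_loops !size_nontrivial_unity_roots.
rewrite /link_signature (@form_signature_diag _ I _
  (fun i => torus_row n q (real_eigen_fun (zeta i) (eta i))) card_I _
  (fun i => eigen_norm (zeta i) (eta i))).
- rewrite [RHS]big_tnth; under [RHS]eq_bigr do rewrite big_tnth.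
  rewrite pair_bigA /=; apply: eq_bigr => i _.
  rewrite /eigen_norm -mulrN sgzM gtr0_sgz ?mul1r //.
  by rewrite !mulr_gt0 ?ltr0n.
- move=> i j; rewrite (torus_form_orthogonal (zetaU i) (etaU i) (zetaU j) (etaU j)).
  have inj m : (0 < m)%N -> injective (tnth (in_tuple (nontrivial_unity_roots C m))).
    by move=> m_gt0; apply/tuple_uniqP/uniq_nontrivial_unity_roots.
  rewrite /zeta /eta (inj_eq (inj _ (ltn0Sn n))) (inj_eq (inj _ q_gt0)).
  by rewrite -xpair_eqE -!surjective_pairing.
- by move=> i; exact: eigen_norm_neq0 p_odd q_odd (zetaU i) (etaU i).
Qed.

End TorusSignature.

(** * Conjugation in a ring *)

Section Conjugation.
Variable T : unitRingType.
Implicit Types a b k : T.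

Lemma conjM k a b : k \is a GRing.unit -> k * (a * b) * k^-1 = (k * a * k^-1) * (k * b * k^-1).
Proof. by move=> kU; rewrite !mulrA mulrVK. Qed.

Lemma conjX k a m : k \is a GRing.unit -> k * a ^+ m * k^-1 = (k * a * k^-1) ^+ m.
Proof.
move=> kU; elim: m => [|m IHm]; first by rewrite !expr0 mulr1 mulrV.
by rewrite !exprS conjM // IHm.
Qed.

Lemma conjV k a : k \is a GRing.unit -> a \is a GRing.unit ->
  k * a^-1 * k^-1 = (k * a * k^-1)^-1.
Proof. by move=> kU aU; rewrite !invrM ?unitrMl ?unitrV // invrK mulrA. Qed.

Lemma conj_sign k m : k \is a GRing.unit -> k * (-1) ^+ m * k^-1 = (-1) ^+ m.
Proof. by move=> kU; rewrite conjX // mulrN1 mulNr mulrV. Qed.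

Lemma conjK k a : k \is a GRing.unit -> k^-1 * (k * a * k^-1) * k = a.
Proof. by move=> kU; rewrite !mulrA mulVr // mul1r mulrVK. Qed.

Lemma conj_eq k a b : k \is a GRing.unit -> k * a = b * k -> k * a * k^-1 = b.
Proof. by move=> kU ->; rewrite mulrK. Qed.

Lemma conj_anticommute k a b : k \is a GRing.unit -> a * b = - (b * a) ->
  k^-1 * a * k * (k^-1 * b * k) = - (k^-1 * b * k * (k^-1 * a * k)).
Proof.
move=> kU ab.
have regroup c d : k^-1 * c * k * (k^-1 * d * k) = k^-1 * (c * d) * k by rewrite !mulrA mulrK.
by rewrite !regroup ab mulrN mulNr.
Qed.

End Conjugation.

(** * The group of a torus knot *)

Section TorusGroup.
Variable T : unitRingType.
Implicit Types (x : nat -> T) (g h y s : T).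

Definition partial_prod x m : T := \prod_(i < m) x i.

Lemma partial_prodS x m : partial_prod x m.+1 = partial_prod x m * x m.
Proof. exact: big_ord_recr. Qed.

Lemma partial_prod_unit x m :
  (forall k, x k \is a GRing.unit) -> partial_prod x m \is a GRing.unit.
Proof.
move=> xU; elim: m => [|m IHm]; first by rewrite /partial_prod big_ord0 unitr1.
by rewrite partial_prodS unitrMl.
Qed.

(** The effect on the labels of the strands of a positive crossing at position j.
Labels are indexed by all of nat; only those of actual strands matter. *)
Definition crossing_map j x : nat -> T := fun k =>
  if k == j.+1 then x j else if k == j then x j * x j.+1 * (x j)^-1 else x k.

(** The labels above t letters of the word sigma_0 ... sigma_(n-1) repeated, starting
from x. *)
Fixpoint strand_labels n x t : nat -> T :=
  if t is t'.+1 then crossing_map (t' %% n) (strand_labels n x t') else x.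

(** Every label is obtained from the initial ones by conjugation by labels. *)
Lemma strand_labels_ind n x (P : T -> Prop) :
    (forall a b, P a -> P b -> P (a * b * a^-1)) -> (forall k, P (x k)) ->
  forall t k, P (strand_labels n x t k).
Proof.
move=> Pconj Px; elim=> [|t IHt] k //=; rewrite /crossing_map.
by case: eqP => // _; case: eqP => // _; apply: Pconj.
Qed.

Lemma strand_labels_conj n x c t k :
    c \is a GRing.unit -> (forall k, x k \is a GRing.unit) ->
  strand_labels n (fun j => c * x j * c^-1) t k = c * strand_labels n x t k * c^-1.
Proof.
move=> cU xU; have labU := @strand_labels_ind n x (fun a => a \is a GRing.unit) _ xU.
elim: t k => [|t IHt] k //=; rewrite /crossing_map !IHt.
case: eqP => // _; case: eqP => // _.
have {}labU j : strand_labels n x t j \is a GRing.unit.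
  by apply: labU => a b aU bU; rewrite !unitrMl ?unitrV.
by rewrite !invrM ?unitrMl ?unitrV // invrK !mulrA !mulrVK.
Qed.

Lemma conj_torus_generator (c g h : T) e m : c \is a GRing.unit -> h \is a GRing.unit ->
  c * (h ^- m * ((-1) ^+ e * g * h) * h ^+ m) * c^-1
  = (c * h * c^-1) ^- m * ((-1) ^+ e * (c * g * c^-1) * (c * h * c^-1)) * (c * h * c^-1) ^+ m.
Proof.
move=> cU hU.
rewrite !conjM // conjV ?unitrX // !conjX //; congr (_ * (_ * _) * _).
by rewrite -conjX // conj_sign.
Qed.

(** One pass moves the first label to the right end, conjugating by it every label that it
crosses; after j crossings of pass m, this has happened to positions below j. *)
Lemma strand_labels_row n x m j k :
    (forall k, x k \is a GRing.unit) -> (forall k, x (k + n.+1)%N = x k) ->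
    (forall k, (k <= n)%N -> strand_labels n x (m * n) k
       = partial_prod x m * x (k + m)%N * (partial_prod x m)^-1) ->
    (j <= n)%N -> (k <= n)%N ->
  strand_labels n x (m * n + j)%N k
  = if (k < j)%N
    then partial_prod x m.+1 * x (k + m.+1)%N * (partial_prod x m.+1)^-1
    else if k == j then partial_prod x m * x m * (partial_prod x m)^-1
    else partial_prod x m * x (k + m)%N * (partial_prod x m)^-1.
Proof.
move=> xU x_per row0; have PU i := partial_prod_unit i xU.
elim: j k => [|j IHj] k lt_jn le_kn.
  by rewrite addn0 row0 //; case: eqP => // ->.
have modE : ((m * n + j) %% n = j)%N by rewrite modnMDl modn_small.
rewrite addnS /= /crossing_map modE ltnS.
have [->|neq_kj1] := eqVneq k j.+1.
  by rewrite ltnn IHj ?(ltnW lt_jn) // ltnn eqxx.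
have [->|neq_kj] := eqVneq k j.
  rewrite leqnn !IHj ?(ltnW lt_jn) // ltnn eqxx ltnNge leqnSn /= gtn_eqF //.
  rewrite !invrM ?unitrMr ?unitrV // invrK partial_prodS invrM //.
  by rewrite !mulrA !mulrVK // addSnnS.
rewrite IHj ?(ltnW lt_jn) // (negPf neq_kj).
by rewrite [(k <= j)%N]leq_eqVlt (negPf neq_kj).
Qed.

Lemma strand_labels_pass n x m k :
    (forall k, x k \is a GRing.unit) -> (forall k, x (k + n.+1)%N = x k) -> (k <= n)%N ->
  strand_labels n x (m * n) k
  = partial_prod x m * x (k + m)%N * (partial_prod x m)^-1.
Proof.
move=> xU x_per; elim: m k => [|m IHm] k le_kn.
  by rewrite /partial_prod big_ord0 mul1r invr1 mulr1 addn0.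
rewrite mulSn addnC (strand_labels_row xU x_per IHm) //.
case: ltngtP le_kn => // -> _.
rewrite addnS -addSn addnC x_per partial_prodS invrM ?partial_prod_unit //.
by rewrite !mulrA mulrK.
Qed.

(** Here p is the number of strands and u inverts q modulo p. *)
Variables (p q u v : nat).
Hypothesis bezout : (u * q = 1 + v * p)%N.

Lemma partial_prod_conj_powers (h x0 : T) k : h \is a GRing.unit ->
   partial_prod (fun i => h ^- i * x0 * h ^+ i) k = (x0 * h^-1) ^+ k * h ^+ k.
Proof.
move=> hU; elim: k => [|k IHk]; first by rewrite /partial_prod big_ord0 !expr0 mulr1.
rewrite partial_prodS IHk !mulrA mulrK ?unitrX // exprSr -!mulrA; congr (_ * _).
by rewrite exprS !mulrA mulrVK.
Qed.

(** The closing relation says that shifting the index by q is conjugation by the partial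
product. *)
Lemma shift_partial_prod x m k :
    (forall k, x k \is a GRing.unit) ->
    (forall k, x k = partial_prod x q * x (k + q)%N * (partial_prod x q)^-1) ->
  x (k + m * q)%N = partial_prod x q ^- m * x k * partial_prod x q ^+ m.
Proof.
move=> xU x_rel; set y := partial_prod x q.
have yU : y \is a GRing.unit by apply: partial_prod_unit.
elim: m k => [|m IHm] k; first by rewrite expr0 invr1 mul1r mulr1 addn0.
have -> : (k + m.+1 * q = (k + m * q) + q)%N by rewrite mulSn addnCA addnC.
have x_q j : x (j + q)%N = y^-1 * x j * y.
  by rewrite [x j]x_rel -/y !mulrA mulVr // mul1r mulrVK.
by rewrite x_q IHm exprSr [in RHS]invrM ?unitrX // !mulrA.
Qed.

Lemma periodic_mul x m k : (forall k, x (k + p)%N = x k) -> x (k + m * p)%N = x k.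
Proof.
by move=> x_per; elim: m => [|m IHm]; rewrite ?addn0 // mulSn addnCA addnC x_per.
Qed.

(** Shifting p times by q is the identity, as x has period p. *)
Lemma partial_prod_expr_comm x k :
    (forall k, x k \is a GRing.unit) -> (forall k, x (k + p)%N = x k) ->
    (forall k, x k = partial_prod x q * x (k + q)%N * (partial_prod x q)^-1) ->
  GRing.comm (partial_prod x q ^+ p) (x k).
Proof.
move=> xU x_per x_rel; set y := partial_prod x q.
have yU : y ^+ p \is a GRing.unit by rewrite unitrX ?partial_prod_unit.
have := shift_partial_prod p k xU x_rel; rewrite mulnC periodic_mul // -/y => xE.
by rewrite /GRing.comm {1}xE !mulrA mulrV // mul1r.
Qed.

(** Shifting by u q is shifting by 1, so x_(k+1) is a conjugate of x_k by the power u of the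
partial product.  The sign (-1)^e makes the orders of g and h odd, and puts g and h on
an equal footing. *)
Lemma torus_group_structure x e :
    (forall k, x k \is a GRing.unit) -> (forall k, x (k + p)%N = x k) ->
    (forall k, x k = partial_prod x q * x (k + q)%N * (partial_prod x q)^-1) ->
    odd p -> odd q -> partial_prod x q ^+ p = (-1) ^+ e ->
  exists g h, [/\ g ^+ q = 1, h ^+ p = 1, h = ((-1) ^+ e * partial_prod x q) ^+ u
     & forall k, x k = h ^- k * ((-1) ^+ e * g * h) * h ^+ k].
Proof.
move=> xU x_per x_rel p_odd q_odd; set y := partial_prod x q => yp.
have yU : y \is a GRing.unit by apply: partial_prod_unit.
pose s : T := (-1) ^+ e; have ss : s * s = 1 by rewrite -expr2 sqrr_sign.
have sU : s \is a GRing.unit by apply/unitrP; exists s.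
have sC a : s * a = a * s by apply/commr_sym/commr_sign.
have s_odd m : odd m -> s ^+ m = s.
  by move=> m_odd; rewrite -[m]odd_double_half m_odd exprS -mul2n exprM expr2 ss expr1n mulr1.
pose h := (s * y) ^+ u; have hU : h \is a GRing.unit by rewrite unitrX ?unitrMl.
have syE m : (s * y) ^+ m = s ^+ m * y ^+ m by apply/exprMn_comm/sC.
have syp : (s * y) ^+ p = 1 by rewrite syE s_odd // yp ss.
have hp : h ^+ p = 1 by rewrite -exprM mulnC exprM syp expr1n.
have hq : h ^+ q = s * y by rewrite -exprM bezout exprD expr1 mulnC exprM syp expr1n mulr1.
have x_conj m k : x (k + m * q)%N = (s * y) ^- m * x k * (s * y) ^+ m.
  have smC a : s ^+ m * a = a * s ^+ m by apply/commr_sym/commrX/commr_sym/sC.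
  have smU : s ^+ m \is a GRing.unit by apply: unitrX.
  have ymU : y ^+ m \is a GRing.unit by apply: unitrX.
  rewrite shift_partial_prod // -/y syE (invrM smU ymU) -!mulrA; congr (_ * _).
  by rewrite [x k * (_ * _)]mulrA -smC -mulrA mulKr.
have xS k : x k.+1 = h^-1 * x k * h.
  by rewrite /h -x_conj bezout addnA addn1 periodic_mul.
have xE k : x k = h ^- k * x 0 * h ^+ k.
  elim: k => [|k IHk]; first by rewrite expr0 invr1 mul1r mulr1.
  by rewrite xS IHk exprSr invrM ?(unitrX k hU) // !mulrA.
exists (s * x 0 * h^-1), h; split=> //.
- have : y = (x 0 * h^-1) ^+ q * h ^+ q.
    rewrite -partial_prod_conj_powers //; apply: eq_bigr => i _; exact: xE.
  rewrite hq => yE.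
  rewrite -mulrA exprMn_comm; last exact: sC.
  rewrite s_odd // sC; apply: (mulIr yU); rewrite mul1r {2}yE mulrA //.
- move=> k; rewrite {1}xE; congr (_ * _ * _).
  by rewrite -!mulrA mulVr // mulr1 mulrA ss mul1r.
Qed.

(** The converse: with x_k of this form, the partial product of q terms is
((-1)^e g)^q h^q. *)
Lemma torus_group_construction g h e :
    g ^+ q = 1 -> h ^+ p = 1 -> odd p -> odd q -> (0 < p)%N ->
  let x k := h ^- k * ((-1) ^+ e * g * h) * h ^+ k in
  [/\ forall k, x k \is a GRing.unit, forall k, x (k + p)%N = x k,
      partial_prod x q = (-1) ^+ e * h ^+ q,
      forall k, x k = partial_prod x q * x (k + q)%N * (partial_prod x q)^-1
    & h = ((-1) ^+ e * partial_prod x q) ^+ u].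
Proof.
move=> gq hp p_odd q_odd p_gt0 x.
have gU : g \is a GRing.unit by rewrite -(unitrX_pos _ (odd_gt0 q_odd)) gq unitr1.
have hU : h \is a GRing.unit by rewrite -(unitrX_pos _ p_gt0) hp unitr1.
have hXU k : h ^+ k \is a GRing.unit by rewrite unitrX.
pose s : T := (-1) ^+ e; have ss : s * s = 1 by rewrite -expr2 sqrr_sign.
have sU : s \is a GRing.unit by apply/unitrP; exists s.
have sC a : s * a = a * s by apply/commr_sym/commr_sign.
have sq : s ^+ q = s.
  by rewrite -[q]odd_double_half q_odd exprS -mul2n exprM expr2 ss expr1n mulr1.
have Pq : partial_prod x q = s * h ^+ q.
  by rewrite partial_prod_conj_powers // mulrK // exprMn_comm ?sq ?gq ?mulr1 //; apply: sC.
split=> //.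
- by move=> k; rewrite !unitrMl ?unitrV.
- by move=> k; rewrite /x exprD hp mulr1.
- move=> k; transitivity (s * x k * s^-1); first by rewrite sC mulrK.
  by rewrite Pq invrM // /x exprD [in RHS]invrM // !mulrA !mulrK.
- by rewrite Pq mulrA ss mul1r -exprM mulnC bezout exprD expr1 mulnC exprM hp expr1n mulr1.
Qed.

(** The sign, h and g are recovered from the labels: (-1)^e as the p-th power of the partial
product, h as a power of the latter up to sign, and g from the first label. *)
Lemma torus_group_conj_inj (c g h g' h' : T) (e e' : bool) :
    let x k := h ^- k * ((-1) ^+ e * g * h) * h ^+ k in
    let y k := h' ^- k * ((-1) ^+ e' * g' * h') * h' ^+ k in
    g ^+ q = 1 -> h ^+ p = 1 -> g' ^+ q = 1 -> h' ^+ p = 1 ->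
    odd p -> odd q -> (0 < p)%N -> -1 != 1 :> T -> c \is a GRing.unit ->
    (forall k, c * x k * c^-1 = y k) ->
  [/\ e = e', h' = c * h * c^-1 & g' = c * g * c^-1].
Proof.
move=> x y gq hp gq' hp' p_odd q_odd p_gt0 two_neq0 cU xy.
have [xU _ Px _ hx] := torus_group_construction e gq hp p_odd q_odd p_gt0.
have [yU _ Py _ hy] := torus_group_construction e' gq' hp' p_odd q_odd p_gt0.
rewrite -/x in xU Px hx; rewrite -/y in yU Py hy.
have Pxy m : partial_prod y m = c * partial_prod x m * c^-1.
  elim: m => [|m IHm]; first by rewrite /partial_prod !big_ord0 mulr1 mulrV.
  by rewrite !partial_prodS IHm -xy conjM.
have Pp d (a : T) : a ^+ p = 1 -> ((-1) ^+ (d : bool) * a ^+ q) ^+ p = (-1) ^+ d.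
  move=> ap; rewrite exprMn_comm; last by apply/commr_sym/commr_sign.
  rewrite -[X in _ * X]exprM mulnC exprM ap expr1n mulr1 -exprM mulnC exprM.
  by rewrite -signr_odd p_odd expr1.
have ee' : e = e'.
  have : (-1) ^+ e' = (-1) ^+ e :> T.
    by rewrite -(Pp e' h') // -Py Pxy -conjX // Px Pp // conj_sign.
  case: (e) (e') => [] [] //; rewrite expr1 expr0 => /eqP; first by rewrite eq_sym (negPf two_neq0).
  by rewrite (negPf two_neq0).
have hh' : h' = c * h * c^-1.
  by rewrite hy hx Pxy conjX // conjM // -ee' conj_sign.
split=> //.
have g_x0 (a b : T) d : b \is a GRing.unit -> a = (-1) ^+ (d : bool) * ((-1) ^+ d * a * b) * b^-1.
  by move=> bU; rewrite !mulrA mulrK // -expr2 sqrr_sign mul1r.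
have hU : h \is a GRing.unit by rewrite -(unitrX_pos _ p_gt0) hp unitr1.
have hU' : h' \is a GRing.unit by rewrite -(unitrX_pos _ p_gt0) hp' unitr1.
rewrite {1}(g_x0 g' h' e' hU').
have y0 : (-1) ^+ e' * g' * h' = c * ((-1) ^+ e * g * h) * c^-1.
  by have := xy 0%N; rewrite /x /y !expr0 !invr1 !mul1r !mulr1.
by rewrite y0 -ee' hh' -conjV // -{1}(conj_sign e cU) -!conjM // -g_x0.
Qed.

End TorusGroup.

(** * Wirtinger relations of a torus braid *)

Section TorusRepresentations.
Variables (R : realType) (n q : nat).
Local Notation M2 := 'M[R[i]]_2.
Local Notation T := (torus_braid n.+1 q).
Implicit Types (A : edge T -> M2) (x : nat -> M2).

Lemma torus_crossing_relation (t : 'I_(size T)) (y z : 'I_n.+1 -> M2) x :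
    (forall k : 'I_n.+1, y k = x k) ->
  crossing_relation (tnth (in_tuple T) t) y z
  <-> (forall k : 'I_n.+1, z k = crossing_map (t %% n) x k).
Proof.
move=> yE; have [cE bE] := tnth_torus_braid t.
case: (tnth _ t) cE bE => i b /= iE ->; rewrite -iE /crossing_map.
pose l : 'I_n.+1 := widen_ord (leqnSn n) i; pose r : 'I_n.+1 := lift ord0 i.
have rE : nat_of_ord r = i.+1 by [].
have -> : x i = y l by rewrite yE.
have -> : x i.+1 = y r by rewrite yE.
split=> [[/= away_lr zr zl] k|zE].
  have [kr|k_neq_r] := eqVneq (nat_of_ord k) i.+1.
    by have -> : k = r by apply: val_inj.
  have [kl|k_neq_l] := eqVneq (nat_of_ord k) i.
    by have -> : k = l by apply: val_inj.
  by rewrite -yE away_lr.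
split=> [k k_neq_l k_neq_r||] /=.
- by rewrite zE (negPf (k_neq_r : k != i.+1 :> nat)) (negPf (k_neq_l : k != i :> nat)).
- by rewrite zE eqxx.
- by rewrite zE /= ltn_eqF // eqxx.
Qed.

Definition label_edges x : edge T -> M2 := fun e => strand_labels n x e.1 e.2.

(** The labels at the bottom of the braid, extended periodically. *)
Definition meridians A : nat -> M2 := fun k => A (ord0, inord (k %% n.+1)).

Lemma representation_labels A : representation A ->
  (forall e, A e = label_edges (meridians A) e) /\
  (forall k, (k <= n)%N -> strand_labels n (meridians A) (q * n) k = meridians A k).
Proof.
move=> [_ [cross close]].
have AE t (k : 'I_n.+1) : (t <= size T)%N ->
    A (inord t, k) = strand_labels n (meridians A) t k.
  elim: t k => [|t IHt] k le_t.
    by rewrite /= /meridians modn_small // inord_val; congr (A (_, _)); apply: val_inj; rewrite /= inordK.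
  have labE (j : 'I_n.+1) : A (widen_ord (leqnSn _) (Ordinal le_t), j)
      = strand_labels n (meridians A) t j.
    by rewrite -IHt ?(ltnW le_t) //; congr (A (_, _)); apply: val_inj; rewrite /= inordK // ltnS ltnW.
  have /(@torus_crossing_relation _ _ _ _ labE) crossE := cross (Ordinal le_t).
  rewrite [RHS]/= -(crossE k); congr (A (_, _)); apply: val_inj.
  by rewrite /= inordK.
split=> [[t k]|k le_kn]; first by rewrite /label_edges /= -AE ?inord_val // -ltnS.
have lt_k : (k < n.+1)%N by [].
transitivity (A (inord (size T), Ordinal lt_k)).
  by rewrite (AE _ (Ordinal lt_k) (leqnn _)) [in RHS]size_torus_braid.
have -> : inord (size T) = ord_max :> 'I_(size T).+1.
  by apply: val_inj; rewrite /= inordK.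
rewrite close /meridians modn_small //; congr (A (_, _)).
by apply: val_inj; rewrite /= inordK.
Qed.

Lemma labels_representation x :
    (forall t k, SU2 (strand_labels n x t k)) ->
    (forall k, (k <= n)%N -> strand_labels n x (q * n) k = x k) ->
  representation (label_edges x).
Proof.
move=> labSU close; split=> [e|]; first exact: labSU.
split=> [t|k].
  by apply/(@torus_crossing_relation t _ _ (strand_labels n x t)).
by rewrite /label_edges /= size_torus_braid close //; case: k.
Qed.

End TorusRepresentations.

(** * The group SU(2) *)

Section SpecialUnitary.
Variable R : realType.
Local Notation C := R[i].
Local Notation M2 := 'M[C]_2.
Implicit Types (a b : C) (g h : M2).

Lemma ord2_ind (P : 'I_2 -> Prop) : P 0 -> P 1 -> forall i, P i.
Proof.
move=> P0 P1 [[|[|//]] lt_i].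
  by rewrite (_ : Ordinal _ = 0) //; apply: val_inj.
by rewrite (_ : Ordinal _ = 1) //; apply: val_inj.
Qed.

Lemma big_ord2 (V : nmodType) (F : 'I_2 -> V) : \sum_i F i = F 0 + F 1.
Proof.
by rewrite !big_ord_recl big_ord0 addr0; congr (_ + F _); apply: val_inj.
Qed.

Lemma mx2_eq g h : g 0 0 = h 0 0 -> g 0 1 = h 0 1 -> g 1 0 = h 1 0 -> g 1 1 = h 1 1 -> g = h.
Proof. by move=> *; apply/matrixP; elim/ord2_ind; elim/ord2_ind. Qed.

Lemma mul2E g h i j : (g * h) i j = g i 0 * h 0 j + g i 1 * h 1 j.
Proof. by rewrite mxE big_ord2. Qed.

Lemma tr2E g : \tr g = g 0 0 + g 1 1.
Proof. exact: big_ord2. Qed.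

Lemma det2E g : \det g = g 0 0 * g 1 1 - g 0 1 * g 1 0.
Proof.
rewrite (expand_det_row _ 0) big_ord2 /cofactor !det_mx11 !mxE /=.
rewrite expr0 mul1r expr1 mulN1r mulrN; congr (_ * g _ _ - _ * g _ _); exact: val_inj.
Qed.

Definition su2_mx a b : M2 :=
  \matrix_(i, j) if i == 0 then (if j == 0 then a else b)
                 else (if j == 0 then - conjc b else conjc a).

Lemma su2_mxE a b : (su2_mx a b 0 0 = a) * (su2_mx a b 0 1 = b)
  * (su2_mx a b 1 0 = - conjc b) * (su2_mx a b 1 1 = conjc a).
Proof. by rewrite !mxE. Qed.

Lemma su2_mxM a b c d :
  su2_mx a b * su2_mx c d = su2_mx (a * c - b * conjc d) (a * d + b * conjc c).
Proof.
apply: mx2_eq; rewrite mul2E !su2_mxE ?mulrN //.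
  by rewrite !rmorphD !rmorphM /= conjcK; ring.
by rewrite rmorphB !rmorphM /= conjcK; ring.
Qed.

Lemma su2_mx_scalar (r : R) : su2_mx (real_complex R r) 0 = (real_complex R r)%:M.
Proof. by apply: mx2_eq; rewrite !su2_mxE !mxE /= ?conjc0 ?oppr0. Qed.

Lemma su2_mx1 : su2_mx 1 0 = 1.
Proof. by rewrite -[1 in LHS](rmorph1 (real_complex R)) su2_mx_scalar rmorph1. Qed.

Lemma SU2P g : SU2 g <-> exists a b, a * conjc a + b * conjc b = 1 /\ g = su2_mx a b.
Proof.
split=> [[/unitarymxP gU detg]|[a [b [ab1 ->]]]].
  have e00 : g 0 0 * conjc (g 0 0) + g 0 1 * conjc (g 0 1) = 1.
    have := congr1 (fun M : M2 => M 0 0) gU.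
    by rewrite -[_ *m _]/(g * _) mul2E !mxE.
  have e10 : g 1 0 * conjc (g 0 0) + g 1 1 * conjc (g 0 1) = 0.
    have := congr1 (fun M : M2 => M 1 0) gU.
    by rewrite -[_ *m _]/(g * _) mul2E !mxE.
  rewrite det2E in detg.
  exists (g 0 0), (g 0 1); split=> //; apply: mx2_eq; rewrite su2_mxE //.
    rewrite -[LHS]mulr1 -e00; transitivity
      (g 0 0 * (g 1 0 * conjc (g 0 0) + g 1 1 * conjc (g 0 1))
       - conjc (g 0 1) * (g 0 0 * g 1 1 - g 0 1 * g 1 0)); first by ring.
    by rewrite e10 detg mulr0 mulr1 sub0r.
  rewrite -[LHS]mulr1 -e00; transitivity
    (g 0 1 * (g 1 0 * conjc (g 0 0) + g 1 1 * conjc (g 0 1))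
     + conjc (g 0 0) * (g 0 0 * g 1 1 - g 0 1 * g 1 0)); first by ring.
  by rewrite e10 detg mulr0 mulr1 add0r.
split; last first.
  by rewrite det2E !su2_mxE mulrN opprK.
have conjE (c : C) : (Num.conj c) = conjc c by [].
apply/unitarymxP; rewrite -[LHS]/(su2_mx a b * _); apply: mx2_eq; rewrite mul2E !mxE /=.
- by [].
- by rewrite !conjE rmorphN /= !conjcK; ring.
- by rewrite !conjE; ring.
- by rewrite !conjE rmorphN /= !conjcK -ab1; ring.
Qed.

Lemma SU2_unit g : SU2 g -> g \is a GRing.unit.
Proof. by case=> /unitarymx_unit. Qed.

Lemma SU2M g h : SU2 g -> SU2 h -> SU2 (g * h).
Proof.
by move=> [gU dg] [hU dh]; split; [exact: mul_unitarymx|rewrite det_mulmx dg dh mulr1].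
Qed.

Lemma SU2_1 : SU2 (1 : M2).
Proof. by apply/SU2P; exists 1, 0; rewrite su2_mx1 conjc1 mul0r mulr1 addr0. Qed.

Lemma SU2_mxV a b : a * conjc a + b * conjc b = 1 -> (su2_mx a b)^-1 = su2_mx (conjc a) (- b).
Proof.
move=> ab1.
have mul1 : su2_mx a b * su2_mx (conjc a) (- b) = 1.
  rewrite su2_mxM conjcK rmorphN /= mulrN opprK ab1.
  by rewrite [a * - b]mulrN [b * a]mulrC addNr su2_mx1.
have gU : su2_mx a b \is a GRing.unit by apply: SU2_unit; apply/SU2P; exists a, b.
by rewrite -[LHS]mulr1 -mul1 mulKr.
Qed.

Lemma SU2V g : SU2 g -> SU2 g^-1.
Proof.
move=> /SU2P[a [b [ab1 ->]]]; rewrite SU2_mxV //; apply/SU2P.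
by exists (conjc a), (- b); rewrite conjcK rmorphN mulrNN mulrC.
Qed.

Lemma SU2X g m : SU2 g -> SU2 (g ^+ m).
Proof. by move=> gS; elim: m => [|m IHm]; [exact: SU2_1|rewrite exprS; exact: SU2M]. Qed.

Lemma SU2_sign e : SU2 ((-1) ^+ e : M2).
Proof.
apply: SU2X; apply/SU2P; exists (-1), 0; split.
  by rewrite rmorphN rmorph1 mulrNN mulr1 mul0r addr0.
rewrite -[X in - X = _]su2_mx1; apply: mx2_eq; rewrite mxE !su2_mxE ?rmorphN ?oppr0 //.
by rewrite conjc0 !oppr0.
Qed.

Lemma tr_conj g h : h \is a GRing.unit -> \tr (h * g * h^-1) = \tr g.
Proof. by move=> hU; rewrite mxtrace_mulC mulmxA [h^-1 *m h](mulVr hU) mul1mx. Qed.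

Lemma SU2_scalar a : SU2 (a%:M : M2) -> exists e : bool, a%:M = (-1) ^+ e :> M2.
Proof.
move=> [_]; rewrite det_scalar => /eqP; rewrite -subr_eq0 subr_sqr_1 mulf_eq0 subr_eq0 addr_eq0.
case/orP=> /eqP ->; [exists false; by rewrite expr0 | exists true].
by rewrite expr1 raddfN.
Qed.

End SpecialUnitary.

Section NormalForms.
Variable R : realType.
Local Notation C := R[i].
Local Notation M2 := 'M[C]_2.
Local Notation toC := (real_complex R).
Implicit Types (a b w : C) (g h k : M2).

Lemma mulcJ a : a * conjc a = toC (Re a ^+ 2 + Im a ^+ 2).
Proof. by rewrite add_Re2_Im2 sqr_normc. Qed.

Lemma SU2_mx_normsq a b : SU2 (su2_mx a b) ->
  Re a ^+ 2 + Im a ^+ 2 + (Re b ^+ 2 + Im b ^+ 2) = 1.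
Proof.
case=> _; rewrite det2E !su2_mxE mulrN opprK !mulcJ -rmorphD => E.
by apply: (@complexI R); rewrite rmorph1 -E.
Qed.

Lemma SU2_mxP a b : Re a ^+ 2 + Im a ^+ 2 + (Re b ^+ 2 + Im b ^+ 2) = 1 -> SU2 (su2_mx a b).
Proof. by move=> ab1; apply/SU2P; exists a, b; rewrite !mulcJ -rmorphD ab1. Qed.

(** A unit eigenvector (a, b) for the eigenvalue w is the first row of a conjugating matrix in
SU(2); a quarter turn exchanges w and its conjugate if Im w < 0. *)
Lemma SU2_diagonalize g : SU2 g ->
  exists k w, [/\ SU2 k, k * g * k^-1 = su2_mx w 0 & 0 <= Im w].
Proof.
move=> gS; suff [k [w [kS kg]]] : exists k w, SU2 k /\ k * g = su2_mx w 0 * k.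
  have kU := SU2_unit kS; have [Imw_ge0|Imw_lt0] := lerP 0 (Im w).
    by exists k, w; split=> //; apply: conj_eq.
  have JS : SU2 (su2_mx 0 1 : M2).
    by apply: SU2_mxP => /=; rewrite expr0n /= expr1n !add0r addr0.
  exists (su2_mx 0 1 * k), (conjc w); split.
  - exact: SU2M.
  - apply: conj_eq; first by rewrite unitrMl ?SU2_unit.
    rewrite -mulrA kg !mulrA !su2_mxM conjc0 conjc1.
    by congr (su2_mx _ _ * _); ring.
  - by case: w Imw_lt0 {kg} => x y /= /ltW; rewrite oppr_ge0.
have [w /eigenvalueP[v vg v_neq0]] := eigenvalue_closed g isT.
have [c [d [cd1 gE]]] := (SU2P g).1 gS.
set v0 := v 0 0; set v1 := v 0 1.
pose N := Re v0 ^+ 2 + Im v0 ^+ 2 + (Re v1 ^+ 2 + Im v1 ^+ 2).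
have N_gt0 : 0 < N.
  rewrite lt_def !addr_ge0 ?sqr_ge0 // andbT; apply: contra_neq v_neq0 => /eqP.
  rewrite !paddr_eq0 ?addr_ge0 ?sqr_ge0 // !sqrf_eq0 => /andP[/andP[/eqP r0 /eqP i0] /andP[/eqP r1 /eqP i1]].
  have v00 : v0 = 0 by apply/eqP; rewrite eq_complex r0 i0 /= !eqxx.
  have v10 : v1 = 0 by apply/eqP; rewrite eq_complex r1 i1 !eqxx.
  by apply/rowP; elim/ord2_ind; rewrite [RHS]mxE; [exact: v00 | exact: v10].
have eig0 : v0 * c - v1 * conjc d = w * v0.
  have := congr1 (fun u : 'rV_2 => u 0 0) vg.
  by rewrite !mxE big_ord2 gE !su2_mxE mulrN.
have eig1 : v0 * d + v1 * conjc c = w * v1.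
  have := congr1 (fun u : 'rV_2 => u 0 1) vg.
  by rewrite !mxE big_ord2 gE !su2_mxE.
have [r [r_real r2]] : exists r : C, conjc r = r /\ r ^+ 2 * toC N = 1.
  exists (toC (Num.sqrt N)^-1); rewrite conjc_real; split=> //.
  by rewrite -rmorphXn -rmorphM exprVn sqr_sqrtr ?ltW // mulVf ?rmorph1 // gt_eqF.
exists (su2_mx (r * v0) (r * v1)), w; split.
  apply/SU2P; exists (r * v0), (r * v1); split=> //.
  rewrite !rmorphM /= r_real.
  transitivity (r ^+ 2 * (v0 * conjc v0 + v1 * conjc v1)); first by ring.
  by rewrite !mulcJ -rmorphD.
rewrite gE !su2_mxM.
congr su2_mx.
  transitivity (r * (v0 * c - v1 * conjc d)); first by ring.
  by rewrite eig0; ring.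
transitivity (r * (v0 * d + v1 * conjc c)); first by ring.
by rewrite eig1; ring.
Qed.

Lemma su2_mx_diagX w m : su2_mx w 0 ^+ m = su2_mx (w ^+ m) 0.
Proof.
elim: m => [|m IHm]; first by rewrite !expr0 su2_mx1.
by rewrite !exprS IHm su2_mxM conjc0 !(mulr0, mul0r, subr0, addr0).
Qed.

Lemma su2_mx_inj a b a' b' : su2_mx a b = su2_mx a' b' -> a = a' /\ b = b'.
Proof.
move=> E; split; first by rewrite -(su2_mxE a b).1.1.1 E su2_mxE.
by rewrite -(su2_mxE a b).1.1.2 E su2_mxE.
Qed.

Lemma conj_su2_mx_expr k g w m : k \is a GRing.unit -> k * g * k^-1 = su2_mx w 0 ->
  g ^+ m = 1 -> w ^+ m = 1.
Proof.
move=> kU kg gm; have := conjX g m kU; rewrite kg gm mulr1 mulrV // su2_mx_diagX -su2_mx1.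
by case/su2_mx_inj => ->.
Qed.

(** An element of SU(2) is determined up to conjugation by its trace. *)
Lemma SU2_expr_trace g w m : SU2 g -> 0 <= Im w -> Re w ^+ 2 + Im w ^+ 2 = 1 ->
  \tr g = toC (Re w *+ 2) -> (g ^+ m = 1 <-> w ^+ m = 1).
Proof.
move=> gS Imw w1 trg; have [k [w' [kS kg Imw']]] := SU2_diagonalize gS.
have kU := SU2_unit kS.
have w'1 : Re w' ^+ 2 + Im w' ^+ 2 = 1.
  have := SU2_mx_normsq (a := w') (b := 0); rewrite expr0n /= !addr0; apply.
  by rewrite -kg; apply: SU2M (SU2V kS); apply: SU2M.
have Rew' : Re w' = Re w.
  have : \tr (k * g * k^-1) = toC (Re w *+ 2) by rewrite tr_conj.
  have two_neq0 : (2%:R : C) != 0 by rewrite pnatr_eq0.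
  rewrite kg tr2E !su2_mxE addcJ rmorphMn /= -[RHS]mulr_natl.
  by move=> /(mulfI two_neq0) [].
have ww' : w' = w.
  apply/eqP; rewrite eq_complex Rew' eqxx /= -(eqrXn2 (n := 2)) //.
  by apply/eqP; rewrite Rew' in w'1; lra.
split=> [gm|wm]; first by rewrite -ww'; exact: conj_su2_mx_expr kg gm.
have := conjX g m kU; rewrite kg su2_mx_diagX ww' wm su2_mx1 => E.
by rewrite -[g ^+ m](conjK _ kU) E mulr1 mulVr.
Qed.

(** Diagonalize h.  The remaining freedom is conjugation by diagonal matrices, which rotates
the off-diagonal entry of g and makes it positive. *)
Lemma SU2_pair_normal_form g h : SU2 g -> SU2 h -> g * h != h * g ->
  exists k a w (t : R), [/\ SU2 k, k * h * k^-1 = su2_mx w 0, k * g * k^-1 = su2_mx a (toC t),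
    0 < Im w & 0 < t].
Proof.
move=> gS hS gh_neq; have [k [w [kS kh Imw]]] := SU2_diagonalize hS.
have kU := SU2_unit kS.
have /SU2P[a [b [ab1 kg]]] : SU2 (k * g * k^-1) by apply: SU2M (SU2V kS); apply: SU2M.
have neq : su2_mx a b * su2_mx w 0 != su2_mx w 0 * su2_mx a b.
  apply: contra_neq gh_neq; rewrite -kg -kh -!conjM // => E.
  by rewrite -[LHS](conjK _ kU) E conjK.
have Imw_neq0 : Im w != 0.
  apply: contra_neq neq => Imw0; rewrite !su2_mxM conjc0 !(mulr0, mul0r, subr0, addr0, add0r).
  case: w Imw0 {kh Imw} => x y /= ->; rewrite oppr0.
  by congr su2_mx; apply: mulrC.
have b_neq0 : b != 0.
  apply: contra_neq neq => ->; rewrite !su2_mxM conjc0 !(mulr0, mul0r, subr0, addr0, add0r).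
  by congr su2_mx; apply: mulrC.
have w_gt0 : 0 < Im w by rewrite lt_def Imw_neq0.
pose t := Num.sqrt (Re b ^+ 2 + Im b ^+ 2).
have b2_gt0 : 0 < Re b ^+ 2 + Im b ^+ 2.
  rewrite lt_def addr_ge0 ?sqr_ge0 // andbT; apply: contra_neq b_neq0 => /eqP.
  rewrite paddr_eq0 ?sqr_ge0 // !sqrf_eq0 => /andP[/eqP r0 /eqP i0].
  by apply/eqP; rewrite eq_complex r0 i0 /= !eqxx.
have t_gt0 : 0 < t by rewrite sqrtr_gt0.
have [tc tcE tcJ] : exists2 tc, tc = toC t & conjc tc = tc by exists (toC t); rewrite ?conjc_real.
have tc_neq0 : tc != 0 by rewrite tcE fmorph_eq0 gt_eqF.
have tt : tc * tc = b * conjc b by rewrite tcE mulcJ -rmorphM -expr2 sqr_sqrtr ?ltW.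
have cb_neq0 : conjc b != 0 by rewrite conjc_eq0.
(* Conjugation by the diagonal matrix of m multiplies b by m^2. *)
have [m m2] : exists m : C, m ^+ 2 = tc / b by exists (sqrtC (tc / b)); rewrite sqrtCK.
have uJ : tc / b * conjc (tc / b) = 1.
  rewrite rmorphM fmorphV /= tcJ; transitivity (tc * tc / (b * conjc b)).
    by field; rewrite ?b_neq0 ?cb_neq0.
  by rewrite tt divff // mulf_neq0.
have mJ : m * conjc m = 1.
  have : (m * conjc m) ^+ 2 = 1 by rewrite exprMn -rmorphXn m2.
  move=> /eqP; rewrite sqrf_eq1 => /orP[/eqP //|/eqP E].
  by have := mulcJ_ge0 m; rewrite E oppr_ge0 ler10.
have mS : SU2 (su2_mx m 0) by apply/SU2P; exists m, 0; rewrite mJ mul0r addr0.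
have mU := SU2_unit mS.
exists (su2_mx m 0 * k), a, w, t; split=> //.
- exact: SU2M.
- apply: conj_eq; first by rewrite unitrMl.
  have khE : k * h = su2_mx w 0 * k by rewrite -kh mulrVK.
  rewrite -mulrA khE !mulrA !su2_mxM; congr (su2_mx _ _ * _).
    by rewrite ?conjc0; ring.
  by rewrite ?conjc0; ring.
- apply: conj_eq; first by rewrite unitrMl.
  have kgE : k * g = su2_mx a b * k by rewrite -kg mulrVK.
  rewrite -mulrA kgE !mulrA !su2_mxM; congr (su2_mx _ _ * _).
    by rewrite ?conjc0; ring.
  rewrite !(mul0r, mulr0, add0r, addr0) -tcE -[LHS]mul1r -mJ.
  transitivity (m ^+ 2 * b * conjc m); first by ring.
  by rewrite m2 divfK.
Qed.

End NormalForms.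

(** * Pairs with traceless product *)

Section TracelessPairs.
Variable R : realType.
Local Notation C := R[i].
Local Notation M2 := 'M[C]_2.
Local Notation toC := (real_complex R).
Implicit Types (a b z w : C) (g h k : M2).

(** The two matrices generate all matrix units: h has distinct eigenvalues, which gives the
diagonal ones, and the off-diagonal entries of g are non-zero, which gives the others. *)
Lemma su2_pair_irreducible w a b (U : M2) : w - conjc w != 0 -> b != 0 ->
  stablemx U (su2_mx w 0) -> stablemx U (su2_mx a b) -> U = 0 \/ row_full U.
Proof.
move=> w_neq b_neq0 Uh Ug; have cb_neq0 : conjc b != 0 by rewrite conjc_eq0.
have UZ c (f : M2) : stablemx U f -> stablemx U (c *: f).
  by move=> Uf; rewrite -scalemxAr scalemx_sub.
have U00 : stablemx U (delta_mx 0 0 : M2).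
  have -> : delta_mx 0 0 = (w - conjc w)^-1 *: (su2_mx w 0 - (conjc w)%:M) :> M2.
    by apply: mx2_eq; rewrite !mxE /= ?mulVf // ?conjc0 ?subrr ?oppr0 ?addr0 ?mulr0.
  by apply: UZ (stablemxD Uh _); rewrite stablemxN; apply: stablemxC.
have U11 : stablemx U (delta_mx 1 1 : M2).
  have -> : delta_mx 1 1 = 1%:M - delta_mx 0 0 :> M2.
    by apply: mx2_eq; rewrite !mxE /= ?subrr ?subr0.
  by rewrite stablemxD ?stablemxN ?stablemxC.
have U01 : stablemx U (delta_mx 0 1 : M2).
  have -> : delta_mx 0 1 = b^-1 *: (delta_mx 0 0 * su2_mx a b * delta_mx 1 1) :> M2.
    by apply: mx2_eq; rewrite [RHS]mxE !mul2E !mxE /=; field.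
  exact: UZ (stablemxM (stablemxM U00 Ug) U11).
have U10 : stablemx U (delta_mx 1 0 : M2).
  have -> : delta_mx 1 0 = - (conjc b)^-1 *: (delta_mx 1 1 * su2_mx a b * delta_mx 0 0) :> M2.
    by apply: mx2_eq; rewrite [RHS]mxE !mul2E !mxE /=; field.
  exact: UZ (stablemxM (stablemxM U11 Ug) U00).
have Udelta i j : stablemx U (delta_mx i j) by elim/ord2_ind: i; elim/ord2_ind: j.
have [->|U_neq0] := eqVneq U 0; [by left | right].
have /matrix0Pn[i [j Uij]] := U_neq0.
rewrite -sub1mx; apply/row_subP => k.
have : (row i U *m delta_mx j k <= U)%MS.
  by apply: submx_trans (Udelta j k); rewrite submxMr // row_sub.
have -> : row i U *m delta_mx j k = U i j *: row k 1%:M.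
  apply/rowP => l; rewrite !mxE (bigD1 j) //= big1 => [|m /negPf jm]; rewrite !mxE.
    by rewrite eqxx addr0 [k == l]eq_sym.
  by rewrite jm mulr0.
by rewrite eqmx_scale.
Qed.

(** The element g of SU(2) with eigenvalues z and conj z, such that g h is traceless for
h = diag (w, conj w), and with positive off-diagonal entry. *)
Definition pair_mx w z : M2 :=
  su2_mx (Complex (Re z) (Re z * Re w / Im w))
         (toC (Num.sqrt (1 - (Re z / Im w) ^+ 2))).

Definition admissible w z := [&& 0 < Im w, 0 < Im z & Re w ^+ 2 + Re z ^+ 2 < 1].

Section Admissible.
Variables w z : C.
Hypotheses (w1 : Re w ^+ 2 + Im w ^+ 2 = 1) (z1 : Re z ^+ 2 + Im z ^+ 2 = 1).
Hypothesis wz : admissible w z.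

Lemma admissible_radicand_gt0 : 0 < 1 - (Re z / Im w) ^+ 2.
Proof.
have /and3P[Imw Imz lt1] := wz.
rewrite subr_gt0 expr_div_n ltr_pdivrMr ?exprn_gt0 // mul1r.
by move: lt1; rewrite -[X in _ < X]w1 ltrD2l.
Qed.

Lemma SU2_pair_mx : SU2 (pair_mx w z).
Proof.
have /and3P[Imw Imz lt1] := wz.
apply: SU2_mxP; rewrite /= expr0n addr0 sqr_sqrtr ?ltW ?admissible_radicand_gt0 //.
have Imw_neq0 : Im w != 0 by rewrite gt_eqF.
have -> : (Re z * Re w / Im w) ^+ 2 = (Re z / Im w) ^+ 2 * (1 - Im w ^+ 2).
  by rewrite -w1; field.
by field.
Qed.

Lemma SU2_diag_mx : SU2 (su2_mx w 0).
Proof. by apply: SU2_mxP; rewrite /= expr0n !addr0. Qed.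

Lemma tr_pair_mx : \tr (pair_mx w z) = toC (Re z *+ 2).
Proof. by rewrite tr2E !su2_mxE addcJ rmorphMn /= -[RHS]mulr_natl. Qed.

Lemma tr_pair_mxM : \tr (pair_mx w z * su2_mx w 0) = 0.
Proof.
have /and3P[Imw _ _] := wz; have Imw_neq0 : Im w != 0 by rewrite gt_eqF.
rewrite su2_mxM tr2E !su2_mxE addcJ conjc0 mulr0 subr0.
case: w Imw_neq0 => c d /= d_neq0; rewrite (_ : _ - _ = 0) ?mulr0 //; by field.
Qed.

Lemma pair_mx_expr m : z ^+ m = 1 -> pair_mx w z ^+ m = 1.
Proof.
have /and3P[_ Imz _] := wz; move=> zm.
exact/(SU2_expr_trace m SU2_pair_mx (ltW Imz) z1 tr_pair_mx).
Qed.

Lemma pair_mx_irreducible (U : M2) :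
  stablemx U (su2_mx w 0) -> stablemx U (pair_mx w z) -> U = 0 \/ row_full U.
Proof.
have /and3P[Imw _ _] := wz; apply: su2_pair_irreducible.
  case: w Imw => c d /= d_gt0.
  by rewrite eq_complex /= negb_and opprK (gt_eqF (addr_gt0 d_gt0 d_gt0)) orbT.
by rewrite fmorph_eq0 gt_eqF // sqrtr_gt0 admissible_radicand_gt0.
Qed.

End Admissible.

(** For w = c + i d and a = x + i y, the trace condition reads x c = y d, and det g = 1 then
forces t^2 = 1 - (x / d)^2. *)
Lemma traceless_pair_normal_form w a (t : R) :
    Re w ^+ 2 + Im w ^+ 2 = 1 -> 0 < Im w -> 0 < t -> SU2 (su2_mx a (toC t)) ->
    \tr (su2_mx a (toC t) * su2_mx w 0) = 0 ->
  exists z, [/\ Re z ^+ 2 + Im z ^+ 2 = 1, admissible w z & su2_mx a (toC t) = pair_mx w z].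
Proof.
move=> w1 Imw t_gt0 /SU2_mx_normsq; rewrite /= expr0n /= addr0 => at1.
rewrite su2_mxM tr2E !su2_mxE addcJ conjc0 mulr0 subr0 => /eqP.
rewrite mulf_eq0 pnatr_eq0 fmorph_eq0 /=.
have Imw_neq0 : Im w != 0 by rewrite gt_eqF.
case: a at1 => x y /= at1; case: w w1 Imw Imw_neq0 => c d /= w1 d_gt0 d_neq0.
rewrite subr_eq0 => /eqP yE.
have {yE} yE : y = x * c / d by rewrite yE mulfK.
have t2 : t ^+ 2 = 1 - (x / d) ^+ 2.
  have -> : (x / d) ^+ 2 = x ^+ 2 + y ^+ 2.
    have -> : x ^+ 2 = (x / d) ^+ 2 * d ^+ 2 by field.
    have -> : y ^+ 2 = (x / d) ^+ 2 * c ^+ 2 by rewrite yE; field.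
    by rewrite -mulrDr addrC w1 mulr1.
  lra.
exists (Complex x (Num.sqrt (1 - x ^+ 2))); rewrite /admissible /=.
have x2 : 0 < 1 - x ^+ 2 by nra.
rewrite sqr_sqrtr ?ltW // sqrtr_gt0 x2 d_gt0; split; first by ring.
  have : (x / d) ^+ 2 < 1 by rewrite -subr_gt0 -t2 exprn_gt0.
  by rewrite expr_div_n ltr_pdivrMr ?exprn_gt0 // mul1r -w1 ltrD2l => ->.
congr su2_mx; first by rewrite yE.
by rewrite /= -t2 sqrtr_sqr gtr0_norm.
Qed.

End TracelessPairs.

(** * Classification of irreducible traceless representations *)

Section IrreducibleRepresentations.
Variables (R : realType) (n q : nat).
Local Notation C := R[i].
Local Notation M2 := 'M[C]_2.
Local Notation p := n.+1.
Local Notation T := (torus_braid p q).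
Local Notation toC := (real_complex R).
Implicit Types (A : edge T -> M2).

(** Schur's lemma: an eigenspace of M is invariant. *)
Lemma irreducible_comm_scalar A (M : M2) : irreducible A ->
  (forall e, GRing.comm M (A e)) -> exists c, M = c%:M.
Proof.
move=> A_irr MA; have [c Mc] := eigenvalue_closed M isT; exists c.
case: (A_irr (eigenspace M c)) => [e|E0|full].
- by apply: comm_mx_stable_eigenspace; apply: MA.
- by move: Mc; rewrite /eigenvalue E0 eqxx.
have := submx_full (1%:M : M2) full; move=> /eigenspaceP.
by rewrite mul1mx scalemx1.
Qed.

Variables (u v : nat).
Hypotheses (p_odd : odd p) (q_odd : odd q) (bezout : (u * q = 1 + v * p)%N).

(** The index is the sign exponent, with the eigenvalues of h and of g. *)
Definition torus_tuple (i : bool * (C * C)) : nat -> M2 := fun k =>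
  su2_mx i.2.1 0 ^- k * ((-1) ^+ i.1 * pair_mx i.2.1 i.2.2 * su2_mx i.2.1 0)
  * su2_mx i.2.1 0 ^+ k.

Lemma torus_tupleE e w z k : torus_tuple (e, (w, z)) k
  = su2_mx w 0 ^- k * ((-1) ^+ e * pair_mx w z * su2_mx w 0) * su2_mx w 0 ^+ k.
Proof. by []. Qed.

Definition torus_rep i : edge T -> M2 := label_edges (torus_tuple i).

Definition admissible_pairs : seq (C * C) :=
  [seq wz <- [seq (w, z) | w <- upper_unity_roots R p, z <- upper_unity_roots R q]
     | Re wz.1 ^+ 2 + Re wz.2 ^+ 2 < 1].

Definition torus_rep_indices : seq (bool * (C * C)) :=
  [seq (e, wz) | e <- [:: false; true], wz <- admissible_pairs].

Lemma mem_upper_unity_roots m (x : C) : (0 < m)%N ->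
  (x \in upper_unity_roots R m) = (0 < Im x) && (x ^+ m == 1).
Proof.
move=> m_gt0; rewrite mem_filter mem_nontrivial_unity_roots //.
have [Imx|] //= := ltrP 0 (Im x); rewrite (_ : x != 1) ?andbT //.
by apply: contraTneq Imx => ->; rewrite ltxx.
Qed.

Lemma mem_torus_rep_indices e w z : (e, (w, z)) \in torus_rep_indices ->
  [/\ w ^+ p = 1, z ^+ q = 1, Re w ^+ 2 + Im w ^+ 2 = 1, Re z ^+ 2 + Im z ^+ 2 = 1
    & admissible w z].
Proof.
move=> /allpairsP[[e' [w' z']] /= [_ + [_ -> ->]]] {e w z e'}.
rewrite mem_filter /= => /andP[lt1 /allpairsP[[w z] /= [wU zU [wE zE]]]].
move: lt1 wU zU; rewrite {}wE {}zE => lt1; rewrite !mem_upper_unity_roots ?odd_gt0 //.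
move=> /andP[Imw /eqP wp] /andP[Imz /eqP zq].
split=> //; last exact/and3P.
  exact: unity_root_normsq (ltn0Sn n) wp.
exact: unity_root_normsq (odd_gt0 q_odd) zq.
Qed.

Lemma in_torus_rep_indices e w z : w ^+ p = 1 -> z ^+ q = 1 -> admissible w z ->
  (e, (w, z)) \in torus_rep_indices.
Proof.
move=> wp zq /and3P[Imw Imz lt1]; apply: (allpairs_f pair); first by case: e.
rewrite mem_filter /= lt1; apply: (allpairs_f pair).
  by rewrite mem_upper_unity_roots // Imw wp eqxx.
by rewrite mem_upper_unity_roots ?odd_gt0 // Imz zq eqxx.
Qed.

Lemma size_torus_rep_indices :
  (size torus_rep_indices
  = 2 * \sum_(w <- upper_unity_roots R p) \sum_(z <- upper_unity_roots R q)
        ((Re w ^+ 2 + Re z ^+ 2 < 1)%R : nat))%N.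
Proof.
by rewrite size_allpairs size_filter -sum1_count big_mkcond big_allpairs; congr (_ * _)%N.
Qed.

Lemma uniq_torus_rep_indices : uniq torus_rep_indices.
Proof.
apply: allpairs_uniq => //; last by move=> [? ?] [? ?] _ _ [-> ->].
apply/filter_uniq/allpairs_uniq.
- by apply/filter_uniq/uniq_nontrivial_unity_roots.
- by apply/filter_uniq/uniq_nontrivial_unity_roots/odd_gt0.
by move=> [? ?] [? ?] _ _ [-> ->].
Qed.

Section Model.
Variable i : bool * (C * C).
Hypothesis iI : i \in torus_rep_indices.
Local Notation h := (su2_mx i.2.1 0).
Local Notation g := (pair_mx i.2.1 i.2.2).
Local Notation s := ((-1) ^+ i.1 : M2).

Lemma torus_tuple_structure :
  [/\ SU2 g, SU2 h, g ^+ q = 1, h ^+ p = 1 & admissible i.2.1 i.2.2].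
Proof.
case: i iI => e [w z] /mem_torus_rep_indices[wp zq w1 z1 wz] /=.
split=> //; [exact: SU2_pair_mx|exact: SU2_diag_mx|exact: pair_mx_expr|].
by rewrite su2_mx_diagX wp su2_mx1.
Qed.

Lemma torus_tuple_relations :
  [/\ forall k, torus_tuple i k \is a GRing.unit,
      forall k, torus_tuple i (k + p)%N = torus_tuple i k,
      partial_prod (torus_tuple i) q = s * h ^+ q,
      forall k, torus_tuple i k = partial_prod (torus_tuple i) q * torus_tuple i (k + q)%N
                                  * (partial_prod (torus_tuple i) q)^-1
    & h = (s * partial_prod (torus_tuple i) q) ^+ u].
Proof.
have [_ _ gq hp _] := torus_tuple_structure.
exact: (torus_group_construction bezout i.1 gq hp p_odd q_odd (ltn0Sn n)).
Qed.

Lemma traceless_SU2_torus_tuple k : SU2 (torus_tuple i k) /\ \tr (torus_tuple i k) = 0.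
Proof.
have [gS hS _ _ adm] := torus_tuple_structure.
have zS : SU2 (s * g * h) by apply: SU2M hS; apply: SU2M gS; apply: SU2_sign.
have hkS := SU2X k hS; split.
  exact: SU2M (SU2M (SU2V hkS) zS) hkS.
have hkU := SU2_unit (SU2V hkS).
rewrite /torus_tuple -[X in _ * X]invrK tr_conj // -mulrA.
have trgh : \tr (g * h) = 0.
  by case: i iI adm => e [w z] /mem_torus_rep_indices[_ _ w1 z1 wz] _; exact: tr_pair_mxM wz.
by case: (i.1); rewrite ?expr1 ?expr0 ?mulN1r ?mul1r // raddfN /= trgh oppr0.
Qed.

Lemma torus_rep_representation : representation (torus_rep i).
Proof.
have [xU x_per _ x_rel _] := torus_tuple_relations.
apply: labels_representation => [t k|k le_kn].
  apply: strand_labels_ind => [a b aS bS|j]; last by have [] := traceless_SU2_torus_tuple j.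
  by apply: SU2M (SU2V aS); apply: SU2M.
by rewrite strand_labels_pass // -x_rel.
Qed.

Lemma torus_rep_traceless : traceless (torus_rep i).
Proof.
move=> e; suff: SU2 (torus_rep i e) /\ \tr (torus_rep i e) = 0 by case.
apply: (@strand_labels_ind _ n _ (fun a => SU2 a /\ \tr a = 0)) => [a b|j];
  last exact: traceless_SU2_torus_tuple.
move=> [aS _] [bS trb].
by split; [apply: SU2M (SU2V aS); apply: SU2M | rewrite tr_conj ?SU2_unit].
Qed.

(** Conversely to the construction, h and g are products of labels and their signs. *)
Lemma torus_rep_irreducible : irreducible (torus_rep i).
Proof.
move=> U Ustab; have [xU x_per _ x_rel hE] := torus_tuple_relations.
have [gS hS gq hp adm] := torus_tuple_structure.
have Ux k : stablemx U (torus_tuple i k).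
  have -> : torus_tuple i k = torus_rep i (ord0, inord (k %% p)).
    rewrite /torus_rep /label_edges /= inordK ?ltn_pmod //.
    by rewrite {1}(divn_eq k p) addnC periodic_mul.
  exact: Ustab.
have UM (a b : M2) : stablemx U a -> stablemx U b -> stablemx U (a * b) by exact: stablemxM.
have U1 : stablemx U (1 : M2) by exact: stablemxC.
have UX (a : M2) m : stablemx U a -> stablemx U (a ^+ m).
  by move=> Ua; elim: m => [|m IHm]; rewrite ?expr0 // exprS; apply: UM.
have Us : stablemx U s by apply: UX; rewrite stablemxN.
have UP m : stablemx U (partial_prod (torus_tuple i) m).
  elim: m => [|m IHm]; first by rewrite /partial_prod big_ord0.
  by rewrite partial_prodS; apply: UM.
have Uh : stablemx U h by rewrite hE; apply/UX/UM.
have w1 : Re i.2.1 ^+ 2 + Im i.2.1 ^+ 2 = 1.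
  by case: i iI => e [w z] /mem_torus_rep_indices[].
apply: (pair_mx_irreducible w1 adm Uh).
have -> : g = s * torus_tuple i 0 * h ^+ n.
  rewrite /torus_tuple !expr0 invr1 mul1r mulr1 !mulrA -expr2 sqrr_sign mul1r.
  by rewrite -mulrA -exprS hp mulr1.
by apply: (UM _ _ _ (UX _ _ Uh)); apply: UM.
Qed.

End Model.

(** The elements g and h given by [torus_group_structure] cannot commute: otherwise they
commute with all labels, are scalar by Schur's lemma, and the first label is 1 or -1,
whose trace is not 0.  So the normal forms apply. *)
Lemma irreducible_traceless_classification A :
    representation A -> traceless A -> irreducible A ->
  exists2 i, i \in torus_rep_indices
    & exists k, SU2 k /\ conjugate_rep k A = torus_rep i.
Proof.
move=> A_rep A_tr A_irr; have [labE close] := representation_labels A_rep.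
set x := meridians A in labE close.
have [AS _] := A_rep; have xS k : SU2 (x k) by apply: AS.
have xU k := SU2_unit (xS k).
have x_tr k : \tr (x k) = 0 by apply: A_tr.
have x_per k : x (k + p)%N = x k by rewrite /x /meridians modnDr.
have x_rel k : x k = partial_prod x q * x (k + q)%N * (partial_prod x q)^-1.
  have x_mod j : x j = x (j %% p)%N by rewrite /x /meridians modn_mod.
  have le_kn : (k %% p <= n)%N by rewrite -ltnS ltn_mod.
  rewrite [LHS]x_mod -(close _ le_kn) (strand_labels_pass q xU x_per le_kn).
  by rewrite [x (k %% p + q)%N]x_mod modnDml -x_mod.
have comm_A (M : M2) : M \is a GRing.unit -> (forall k, GRing.comm M (x k)) ->
    exists c, M = c%:M.
  move=> MU Mx; apply: (irreducible_comm_scalar A_irr) => e; rewrite labE.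
  have [] // : strand_labels n x e.1 e.2 \is a GRing.unit
             /\ GRing.comm M (strand_labels n x e.1 e.2).
  apply: (@strand_labels_ind _ n _ (fun a => a \is a GRing.unit /\ GRing.comm M a)) => [a b|//].
  move=> [aU Ma] [bU Mb]; split; first by rewrite !unitrMl ?unitrV.
  by apply: commrM (commrV Ma); apply: commrM.
have PS m : SU2 (partial_prod x m).
  elim: m => [|m IHm]; first by rewrite /partial_prod big_ord0; apply: SU2_1.
  by rewrite partial_prodS; apply: SU2M.
have [e Pp] : exists e : bool, partial_prod x q ^+ p = (-1) ^+ e.
  have [|k|c cE] := comm_A (partial_prod x q ^+ p).
  - by rewrite unitrX ?SU2_unit.
  - exact: partial_prod_expr_comm.
  by have := SU2X p (PS q); rewrite cE => /SU2_scalar.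
have [g [h [gq hp hE xE]]] := torus_group_structure bezout xU x_per x_rel p_odd q_odd Pp.
have hS : SU2 h by rewrite hE; apply/SU2X/SU2M/PS/SU2_sign.
have x0 : x 0 = (-1) ^+ e * g * h by rewrite xE !expr0 invr1 mul1r mulr1.
have gS : SU2 g.
  have -> : g = (-1) ^+ e * x 0 * h^-1.
    by rewrite x0 !mulrA -expr2 sqrr_sign mul1r mulrK ?SU2_unit.
  by apply: SU2M (SU2V hS); apply/SU2M/xS/SU2_sign.
have gh_neq : g * h != h * g.
  apply/eqP => gh; have hU := SU2_unit hS; have gU := SU2_unit gS.
  have comm_x (M : M2) : GRing.comm M g -> GRing.comm M h -> forall k, GRing.comm M (x k).
    move=> Mg Mh k; rewrite xE; apply: commrM (commrX _ Mh).
    apply: commrM; first exact: commrV (commrX _ Mh).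
    by apply: commrM Mh; apply: commrM Mg; apply: commr_sign.
  have [c cE] := comm_A h hU (comm_x h (commr_sym gh) (commr_refl h)).
  have [d dE] := comm_A g gU (comm_x g (commr_refl g) gh).
  have [b bE] : exists b : bool, h = (-1) ^+ b by move: hS; rewrite cE; apply: SU2_scalar.
  have [b' b'E] : exists b' : bool, g = (-1) ^+ b' by move: gS; rewrite dE; apply: SU2_scalar.
  have := x_tr 0%N; rewrite x0 bE b'E -!exprD -signr_odd.
  by case: odd; rewrite ?expr1 ?raddfN /= mxtrace1 => /eqP; rewrite ?oppr_eq0 pnatr_eq0.
have [k [a [w [t [kS kh kg Imw t_gt0]]]]] := SU2_pair_normal_form gS hS gh_neq.
have kU := SU2_unit kS; have hU := SU2_unit hS.
have dS : SU2 (su2_mx w 0) by rewrite -kh; apply: SU2M (SU2V kS); apply: SU2M.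
have w1 : Re w ^+ 2 + Im w ^+ 2 = 1.
  by have := SU2_mx_normsq dS; rewrite /= expr0n /= !addr0.
have atS : SU2 (su2_mx a (toC t)) by rewrite -kg; apply: SU2M (SU2V kS); apply: SU2M.
have tr0 : \tr (su2_mx a (toC t) * su2_mx w 0) = 0.
  rewrite -kg -kh -conjM // tr_conj //.
  have := x_tr 0%N; rewrite x0 -mulrA; case: e {Pp hE xE x0}; rewrite ?expr1 ?expr0 ?mulN1r ?mul1r //.
  by rewrite raddfN /= => /eqP; rewrite oppr_eq0 => /eqP.
have [z [z1 wz gE]] := traceless_pair_normal_form w1 Imw t_gt0 atS tr0.
exists (e, (w, z)).
  apply: in_torus_rep_indices => //; first exact: conj_su2_mx_expr kU kh hp.
  have /and3P[_ Imz _] := wz.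
  apply/(SU2_expr_trace q (SU2_pair_mx w1 wz) (ltW Imz) z1); first exact: tr_pair_mx.
  by rewrite -gE -kg -conjX // gq mulr1 mulrV.
exists k; split=> //; apply/funext => ed; rewrite /conjugate_rep labE /torus_rep /label_edges.
rewrite -strand_labels_conj //; congr (strand_labels _ _ _ _); apply/funext => m.
by rewrite [x m]xE torus_tupleE (conj_torus_generator g e m kU hU) kg kh gE.
Qed.

(** The eigenvalues w and z lie in the upper half plane, so they are determined by the traces
of h and of g. *)
Lemma torus_rep_inj i j k : i \in torus_rep_indices -> j \in torus_rep_indices -> SU2 k ->
  conjugate_rep k (torus_rep i) = torus_rep j -> i = j.
Proof.
move=> iI jI kS conj_ij; have kU := SU2_unit kS.
have [xU x_per Pi _ hi] := torus_tuple_relations iI.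
have [yU y_per Pj _ hj] := torus_tuple_relations jI.
have [_ _ gq hp _] := torus_tuple_structure iI.
have [_ _ gq' hp' _] := torus_tuple_structure jI.
have xy m : k * torus_tuple i m * k^-1 = torus_tuple j m.
  have := congr1 (fun A : edge T -> M2 => A (ord0, inord (m %% p))) conj_ij.
  rewrite /conjugate_rep /torus_rep /label_edges /= inordK ?ltn_pmod //.
  have iE : torus_tuple i m = torus_tuple i (m %% p)%N.
    by have := periodic_mul (m %/ p) (m %% p)%N x_per; rewrite addnC -divn_eq.
  have jE : torus_tuple j m = torus_tuple j (m %% p)%N.
    by have := periodic_mul (m %/ p) (m %% p)%N y_per; rewrite addnC -divn_eq.
  by rewrite iE jE.
have neg1 : -1 != 1 :> M2.
  apply/eqP => /(congr1 (fun M : M2 => \tr M)); rewrite raddfN /= mxtrace1.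
  by move=> /eqP; rewrite eq_sym -subr_eq0 opprK -mulr2n mulrn_eq0 pnatr_eq0.
have [eij hij gij] :=
  torus_group_conj_inj bezout gq hp gq' hp' p_odd q_odd (ltn0Sn n) neg1 kU xy.
have tr_w : \tr (su2_mx j.2.1 0) = \tr (su2_mx i.2.1 0) by rewrite hij tr_conj.
have tr_z : \tr (pair_mx j.2.1 j.2.2) = \tr (pair_mx i.2.1 i.2.2) by rewrite gij tr_conj.
move: tr_w tr_z; rewrite !tr_pair_mx tr2E !su2_mxE tr2E !su2_mxE !addcJ.
case: i j iI jI eij {xU x_per Pi hi yU y_per Pj hj gq hp gq' hp' conj_ij xy hij gij}
  => [e [w z]] [e' [w' z']] /= iI jI ->.
have [_ _ w1 z1 /and3P[Imw Imz _]] := mem_torus_rep_indices iI.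
have [_ _ w'1 z'1 /and3P[Imw' Imz' _]] := mem_torus_rep_indices jI.
have two_neq0 : (2%:R : C) != 0 by rewrite pnatr_eq0.
move=> /(mulfI two_neq0)/complexI Rew /complexI/eqP; rewrite eqr_pMn2r // => /eqP Rez.
have Im_eq (a b : C) : 0 < Im a -> 0 < Im b -> Re a ^+ 2 + Im a ^+ 2 = 1 ->
    Re b ^+ 2 + Im b ^+ 2 = 1 -> Re a = Re b -> a = b.
  move=> Ima Imb a1 b1 Reab; apply/eqP; rewrite eq_complex Reab eqxx /=.
  rewrite -(eqrXn2 (n := 2)) ?ltW //; apply/eqP/(addrI (Re a ^+ 2)).
  by rewrite a1 Reab b1.
by rewrite (Im_eq w' w) // (Im_eq z' z).
Qed.

End IrreducibleRepresentations.

(** * Morse-Bott circles *)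

Section Circles.
Variables (R : realType) (n : nat) (w : braid n).
Local Notation C := R[i].
Local Notation M2 := 'M[C]_2.
Implicit Types (rho : edge w -> M2) (g k B : M2).

Lemma conjugate_rep1 rho : conjugate_rep 1 rho = rho.
Proof. by apply/funext => e; rewrite /conjugate_rep invr1 mulr1 mul1r. Qed.

Lemma conjugate_repM g k rho : SU2 g -> SU2 k ->
  conjugate_rep g (conjugate_rep k rho) = conjugate_rep (g * k) rho.
Proof.
move=> /SU2_unit gU /SU2_unit kU; apply/funext => e.
by rewrite /conjugate_rep invrM // !mulrA.
Qed.

Lemma morse_bott_circle_conj rho k : SU2 k ->
  morse_bott_circle (conjugate_rep k rho) = morse_bott_circle rho.
Proof.
move=> kS; apply/seteqP; split=> x [x_crit [g [B [gS xE]]]]; split=> //.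
  rewrite xE; exists (g * k), B; split; first exact: SU2M gS kS.
  exact: (congr1 (fun r => conjugacy_class (r, B)) (conjugate_repM rho gS kS)).
rewrite xE; exists (g * k^-1), B; split; first by apply: SU2M (SU2V kS).
by rewrite conjugate_repM ?mulrVK ?SU2_unit //; apply: SU2M (SU2V kS).
Qed.

(** A traceless element is conjugate to diag (z, - z), which anticommutes with a quarter turn.
This makes the circle of a traceless representation non-empty. *)
Lemma exists_anticommuting g : SU2 g -> \tr g = 0 -> exists2 B, SU2 B & g * B = - (B * g).
Proof.
move=> gS trg; have [k [z [kS kg _]]] := SU2_diagonalize gS.
have kU := SU2_unit kS.
have zJ : conjc z = - z.
  have : \tr (k * g * k^-1) = 0 by rewrite tr_conj.
  by rewrite kg tr2E !su2_mxE addrC => /eqP; rewrite addr_eq0 => /eqP.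
have JS : SU2 (su2_mx 0 1 : M2).
  by apply: SU2_mxP => /=; rewrite expr0n /= expr1n !add0r addr0.
exists (k^-1 * su2_mx 0 1 * k); first exact: SU2M (SU2M (SU2V kS) JS) kS.
have anti : su2_mx z 0 * su2_mx 0 1 = - (su2_mx 0 1 * su2_mx z 0) :> M2.
  rewrite !su2_mxM zJ conjc0 conjc1 !(mulr0, mul0r, mulr1, mul1r, addr0, add0r, subr0).
  by apply: mx2_eq; rewrite [RHS]mxE !su2_mxE ?rmorphN /= ?conjc0 ?opprK ?oppr0.
have gE : g = k^-1 * su2_mx z 0 * k by rewrite -kg conjK.
by rewrite gE; exact: conj_anticommute.
Qed.

(** A critical point of the circle of rho is the class of a pair (A, B) with A conjugate to rho,
so the circle remembers the conjugacy class of rho. *)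
Lemma morse_bott_circle_inj rho rho' :
    representation rho -> traceless rho -> morse_bott_circle rho = morse_bott_circle rho' ->
  exists k, SU2 k /\ conjugate_rep k rho' = rho.
Proof.
move=> rho_rep rho_tr eq_circ; have [rhoS _] := rho_rep.
have [B BS anti] := exists_anticommuting (rhoS (base_edge w)) (rho_tr (base_edge w)).
have : morse_bott_circle rho (conjugacy_class (rho, B)).
  split; first by exists (rho, B); [split | reflexivity].
  by exists 1, B; split; [exact: SU2_1 | rewrite conjugate_rep1].
rewrite eq_circ => -[_ [g [B' [gS class_eq]]]].
have : conjugacy_class (rho, B) (rho, B).
  by exists 1; [exact: SU2_1 | rewrite /= conjugate_rep1 invr1 mulr1 mul1r].
rewrite class_eq => -[k kS /= [kE _]].
by exists (k * g); split; [exact: SU2M | rewrite -conjugate_repM].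
Qed.

Lemma free_of_rank_IC_natural (s : seq (set (set (config R w)))) :
    uniq s -> (forall c, @morse_bott_circles R n w c <-> c \in s) ->
  free_of_rank (IC_natural R w) (1 + size s * 2).
Proof.
move=> s_uniq sP.
have alphaP (x : set (config R w)) : [set (@alpha R n w)]%classic x <-> x \in [:: @alpha R n w].
  by rewrite inE; split=> [->|/eqP].
have [sa [sa_uniq sa_full sa_size]] := set_type_enum (isT : uniq [:: @alpha R n w]) alphaP.
have [sc [sc_uniq sc_full sc_size]] := set_type_enum s_uniq sP.
pose gens : seq (generator R w) :=
  [seq inl a | a <- sa] ++ [seq inr (c, b) | c <- sc, b <- [:: false; true]].
have -> : (1 + size s * 2 = size gens)%N.
  by rewrite size_cat size_map size_allpairs sa_size sc_size.
apply: free_of_rank_freeg.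
  rewrite cat_uniq; apply/and3P; split.
  - by rewrite map_inj_uniq // => ? ? [].
  - by apply/hasPn => _ /allpairsP[[c b] [_ _ ->]]; apply/mapP => -[].
  - by apply: allpairs_uniq => // -[? ?] [? ?] _ _ [-> ->].
move=> [a|[c b]]; rewrite mem_cat; apply/orP; [left | right].
  by rewrite map_f.
by apply: (allpairs_f (fun c b => inr (c, b))); last by case: b.
Qed.

End Circles.

Theorem mainTheorem4 (R : realType) (p q : nat)
    (p_gt0 : (0 < p)%N) (q_gt0 : (0 < q)%N)
    (p_odd : odd p) (q_odd : odd q) (pq_coprime : coprime p q) :
  let T := torus_braid p q in
  let a : rat := - (link_signature R T)%:~R / 4 in
  exists2 r : nat, free_of_rank (IC_natural R T) r & r%:R = 1 + 4 * a :> rat.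
Proof.
case: p p_gt0 p_odd pq_coprime => // n _ p_odd pq_coprime T a.
have [u [v bezout]] : exists u v, (u * q = 1 + v * n.+1)%N.
  rewrite coprime_sym in pq_coprime; have /(coprimeP _ q_gt0)[[u v] /= uv] := pq_coprime.
  by exists u, v; lia.
pose s := [seq morse_bott_circle (@torus_rep R n q i) | i <- torus_rep_indices R n q].
have circ_inj : {in torus_rep_indices R n q &,
    injective (fun i => morse_bott_circle (@torus_rep R n q i))}.
  move=> i j iI jI eq_circ.
  have [k [kS kE]] := morse_bott_circle_inj
    (torus_rep_representation p_odd q_odd bezout iI)
    (torus_rep_traceless p_odd q_odd iI) eq_circ.
  exact: esym (torus_rep_inj p_odd q_odd bezout jI iI kS kE).
have s_uniq : uniq s by rewrite (map_inj_in_uniq circ_inj); exact: uniq_torus_rep_indices.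
have sP c : @morse_bott_circles R n T c <-> c \in s.
  split=> [[rho [rho_rep rho_tr rho_irr] <-]|/mapP[i iI ->]].
    have [i iI [k [kS kE]]] :=
      irreducible_traceless_classification p_odd q_odd bezout rho_rep rho_tr rho_irr.
    rewrite -(morse_bott_circle_conj rho kS) kE.
    exact: (map_f (fun i => morse_bott_circle (@torus_rep R n q i)) iI).
  exists (@torus_rep R n q i); last by [].
  have rep := torus_rep_representation p_odd q_odd bezout iI.
  exact: And3 rep (torus_rep_traceless p_odd q_odd iI)
    (torus_rep_irreducible p_odd q_odd bezout iI).
exists (1 + size s * 2)%N; first exact: free_of_rank_IC_natural.
rewrite /a torus_link_signature // size_map size_torus_rep_indices.
set N := (\sum_(w <- _) _)%N.
have -> : \sum_(w <- upper_unity_roots R n.+1) \sum_(z <- upper_unity_roots R q)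
            ((Re w ^+ 2 + Re z ^+ 2 < 1)%R : nat)%:Z = N%:Z.
  rewrite /N (big_morph Posz PoszD (erefl 0%Z)); apply: eq_bigr => w _.
  by rewrite (big_morph Posz PoszD (erefl 0%Z)).
by rewrite rmorphMn rmorphN /= -pmulrn natrD !natrM; field.
Qed.
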